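(* Let $0<\alpha<1$, $T>0$, $J=[0,T]$ and $f\in C(J\times\mathbb{R},\mathbb{R})$. Let $v,w:J\to\mathbb{R}$ be any differentiable functions such that ${}^{ABC}{}_0\mathcal{D}_\tau^\alpha v,\ {}^{ABC}{}_0\mathcal{D}_\tau^\alpha w\in C(J)$, satisfying (i) ${}^{ABC}{}_0\mathcal{D}_\tau^\alpha v(\tau)\le f(\tau,v(\tau))$ for $\tau\in J$, (ii) ${}^{ABC}{}_0\mathcal{D}_\tau^\alpha w(\tau)\ge f(\tau,w(\tau))$ for $\tau\in J$, one of these two inequalities being strict (for all $\tau\in J$). Then $v(0)<w(0)$ implies $v(\tau)<w(\tau)$ for all $\tau\in J$.
   Context: Let $0<\alpha<1$ and let $B$ be a fixed normalization function on $[0,1]$ with $B(\alpha)>0$ and $B(0)=B(1)=1$. The one-parameter Mittag-Leffler function is $\mathbb{E}_\alpha(z)=\sum_{n=0}^\infty \frac{z^n}{\Gamma(n\alpha+1)}$. For $\omega\in H^1(0,T)$ (Sobolev space), the left Atangana--Baleanu--Caputo (ABC) fractional derivative of order $\alpha$ is ${}^{ABC}{}_0\mathcal{D}_\tau^\alpha\omega(\tau)=\frac{B(\alpha)}{1-\alpha}\int_0^\tau \mathbb{E}_\alpha\left[-\frac{\alpha}{1-\alpha}(\tau-\sigma)^\alpha\right]\omega'(\sigma)\,d\sigma$. Functions to which this operator is applied are understood to lie in its domain. $C(J)$ denotes the real continuous functions on $J$. *)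

(* Defs.v *)
From HB Require Import structures.
From mathcomp Require Import all_boot all_order all_algebra.
From mathcomp Require Import all_classical all_reals all_analysis.

Set Implicit Arguments.
Unset Strict Implicit.
Unset Printing Implicit Defensive.

Import Order.TTheory GRing.Theory Num.Theory.
Import numFieldNormedType.Exports.

Local Open Scope classical_set_scope.
Local Open Scope ring_scope.

(* A function on J = [0, T] is represented by a total function R -> R, of which
   only the values on J are relevant. *)

(* Euler's Gamma function, for x > 0. *)
Definition Gamma (R : realType) (x : R) : R :=
  \int[lebesgue_measure]_(t in `]0, +oo[) (t `^ (x - 1) * expR (- t)).

(* The Mittag-Leffler function E_a, restricted to real arguments. *)
Definition mittag_leffler (R : realType) (a z : R) : R :=
  limn (series (fun n : nat => z ^+ n / Gamma (n%:R * a + 1))).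

(* Differentiability on [a, b]: the difference quotient ranges over points of
   [a, b] only, so the derivative is one-sided at the two endpoints. *)
Definition differentiable_on_segment (R : realType) (a b : R) (u : R -> R) :=
  forall t : R, t \in `[a, b] ->
    cvg ((fun s : R => (u s - u t) / (s - t)) @ within `[a, b] t^').

Definition square_integrable (R : realType) (T : R) (u : R -> R) :=
  u \_ `]0, T[ \in Lfun lebesgue_measure 2%:E.

(* C^1 functions with compact support in the open interval ]0, T[; as in
   Brezis, "Functional Analysis, Sobolev Spaces and PDE", section 8.2, these
   are the test functions in the definition of H^1(0, T). *)
Definition test_function (R : realType) (T : R) (phi : R -> R) :=
  [/\ forall x : R, derivable phi x 1,
      continuous (derive1 phi) &
      exists K : set R, [/\ compact K, K `<=` `]0, T[ &
        forall x : R, ~ K x -> phi x = 0]].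

Definition weak_derivative (R : realType) (T : R) (u g : R -> R) :=
  forall phi : R -> R, test_function T phi ->
    \int[lebesgue_measure]_(x in `]0, T[) (u x * derive1 phi x) =
    - \int[lebesgue_measure]_(x in `]0, T[) (g x * phi x).

Definition sobolev_H1 (R : realType) (T : R) (u : R -> R) :=
  square_integrable T u /\
  exists2 g : R -> R, square_integrable T g & weak_derivative T u g.

(* The left ABC derivative with base point 0 and normalization function B.
   For u differentiable and in H^1(0, T), the pointwise derivative of u used
   here agrees almost everywhere on ]0, T[ with the weak derivative of u; its
   values at the endpoints of [0, t] do not affect the integral. *)
Definition ABC (R : realType) (B : R -> R) (a : R) (u : R -> R) (t : R) : R :=
  B a / (1 - a) *
  \int[lebesgue_measure]_(s in `[0, t])
    (mittag_leffler a (- (a / (1 - a)) * (t - s) `^ a) * derive1 u s).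

(* Main.v *)
Require Import Defs.
From HB Require Import structures.
From mathcomp Require Import all_boot all_order all_algebra.
From mathcomp Require Import all_classical all_reals all_analysis.
From mathcomp Require Import measurable_realfun ring lra.

Set Implicit Arguments.
Unset Strict Implicit.
Unset Printing Implicit Defensive.

Import Order.TTheory GRing.Theory Num.Theory.
Import numFieldNormedType.Exports.

Local Open Scope classical_set_scope.
Local Open Scope ring_scope.

(** The difference m = v - w is negative at 0.  If it does not stay negative,
    it has a first zero t1 > 0, where it attains its maximum over [0, t1].  A
    Caputo-type derivative with a nonnegative nonincreasing kernel satisfies a
    maximum principle: it is nonnegative at such a point.  Hence the ABC
    derivative of w at t1 is at most that of v, and as v and w agree at t1 the
    two differential inequalities, one of them strict, contradict each other.

    The maximum principle [ABC_le_of_max_at_end] has three ingredients.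

    1. The kernel s |-> E_a(- lambda (t1 - s)^a) is nonnegative and
    nondecreasing in s, that is, x |-> E_a(- x) is nonnegative and
    nonincreasing on x >= 0 ([mittag_leffler_ge0],
    [mittag_leffler_nonincreasing]).  This is obtained by discretization.  In
    generating functions, the implicit scheme for the fractional relaxation
    equation with parameter mu reads
      ((1 - z)^a + mu) Y(z) = (1 - z)^(a - 1),
    whose solution is the series of (- mu)^k (1 - z)^(- k a - 1).  For
    0 < a <= 1 the coefficients of (1 - z)^a after the first are nonpositive
    and those of (1 - z)^(a - 1) are nonnegative, so by induction the
    coefficients of Y are nonnegative, and by the same induction they decrease
    when mu grows.  For mu = x / N^a the N-th coefficient is the sum over k of
    (- x)^k [z^N](1 - z)^(- k a - 1) / N^(k a).  By the product formula of Gauss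
    [gauss_limit] its k-th term tends to (- x)^k / Gamma(k a + 1), and Tannery's
    theorem [tannery] gives the convergence of the sum to E_a(- x).

    2. A differentiable function in H^1 has an integrable pointwise derivative
    and is its primitive ([sobolev_derivative]).  Testing the weak derivative g
    against C^1 approximations of indicators of intervals shows that u is a
    primitive of g; by Lebesgue's differentiation theorem its pointwise
    derivative is then g almost everywhere.

    3. If all the integrals of p over ]s, t1[ are nonnegative, so is the
    integral of k p over ]0, t1[ for every nonnegative nondecreasing k
    ([monotone_kernel_Rintegral_ge0]): k is a superposition of indicators of its
    superlevel sets, which are final segments of ]0, t1[.  It is applied to
    p = v' - w', whose integral over ]s, t1[ is m(t1) - m(s). *)

(** * Coefficients of negative binomial series *)

(** The coefficient of z^n in (1 - z)^(- x): the rising factorial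
    x (x + 1) ... (x + n - 1) divided by n!. *)
Definition rbin (R : fieldType) (x : R) (n : nat) : R :=
  \prod_(i < n) ((x + i%:R) / i.+1%:R).

Lemma rbin0 (R : fieldType) (x : R) : rbin x 0 = 1.
Proof. by rewrite /rbin big_ord0. Qed.

Lemma rbinS (R : numFieldType) (x : R) n :
  n.+1%:R * rbin x n.+1 = (x + n%:R) * rbin x n.
Proof.
rewrite /rbin big_ord_recr /= mulrCA [X in _ * X]mulrC.
by rewrite divfK ?pnatr_eq0 // mulrC.
Qed.

(** The product of (1 - z)^(- x) and (1 - z)^(- y) is (1 - z)^(- x - y).  Both
    sides satisfy the recurrence [rbinS]: weight the n+1-st convolution by
    n + 1 = i + (n + 1 - i) and apply [rbinS] to each factor. *)
Lemma rbin_vandermonde (R : numFieldType) (x y : R) n :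
  \sum_(i < n.+1) rbin x i * rbin y (n - i) = rbin (x + y) n.
Proof.
elim: n => [|n IH]; first by rewrite big_ord1 !rbin0 mulr1.
apply: (@mulfI _ n.+1%:R); first by rewrite pnatr_eq0.
rewrite rbinS -IH !mulr_sumr.
transitivity (\sum_(i < n.+2) i%:R * rbin x i * rbin y (n.+1 - i) +
   \sum_(i < n.+2) rbin x i * ((n.+1 - i)%:R * rbin y (n.+1 - i))).
  rewrite -big_split /=; apply: eq_bigr => i _.
  have -> : n.+1%:R = i%:R + (n.+1 - i)%:R :> R.
    by rewrite -natrD subnKC // -ltnS.
  ring.
rewrite big_ord_recl /= !mul0r add0r.
rewrite [X in _ + X]big_ord_recr /= subnn mul0r mulr0 addr0 -big_split /=.
apply: eq_bigr => i _.
have le_in : (i <= n)%N by rewrite -ltnS.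
rewrite /bump /= add1n subSS rbinS subSn // rbinS.
have -> : n%:R = i%:R + (n - i)%:R :> R by rewrite -natrD subnKC.
ring.
Qed.

Lemma rbin_ge0 (R : numFieldType) (x : R) n : 0 <= x -> 0 <= rbin x n.
Proof. by move=> x0; apply: prodr_ge0 => i _; rewrite divr_ge0 // addr_ge0. Qed.

(** Only the first factor of the product, - a, can be negative. *)
Lemma rbinN_le0 (R : realFieldType) (a : R) n :
  0 <= a -> a <= 1 -> rbin (- a) n.+1 <= 0.
Proof.
move=> a0 a1; rewrite /rbin big_ord_recl /= addr0 divr1 mulNr oppr_le0.
apply: mulr_ge0 => //; apply: prodr_ge0 => i _; rewrite divr_ge0 //.
by rewrite /bump /= -natr1; have := ler0n R i; lra.
Qed.

Lemma rbin_homo (R : numFieldType) (x : R) m n :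
  1 <= x -> (m <= n)%N -> rbin x m <= rbin x n.
Proof.
move=> x1; elim: n => [|n IH]; first by rewrite leqn0 => /eqP ->.
rewrite leq_eqVlt => /predU1P[-> //|]; rewrite ltnS => /IH /le_trans; apply.
rewrite [leRHS]/rbin big_ord_recr /= -[leLHS]mulr1.
apply: ler_wpM2l; first by rewrite rbin_ge0 // (le_trans _ x1).
by rewrite ler_pdivlMr ?ltr0n // mul1r -natr1 addrC lerD2r.
Qed.

(** In generating functions the equation is ((1 - z)^a + mu) Y = G.  The
    constant coefficient of (1 - z)^a is 1 and the others are nonpositive, so
    (1 + mu) y_n is g_n plus a nonnegative combination of earlier values of y.
    The rank N is there because y will be given by series whose convergence is
    only known up to some rank. *)
Lemma relaxation_ge0 (R : realFieldType) (a mu : R) (g y : nat -> R) N :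
  0 <= a -> a <= 1 -> 0 <= mu ->
  (forall n, (n <= N)%N -> 0 <= g n) ->
  (forall n, (n <= N)%N ->
     \sum_(i < n.+1) rbin (- a) i * y (n - i)%N + mu * y n = g n) ->
  forall n, (n <= N)%N -> 0 <= y n.
Proof.
move=> a0 a1 mu0 g0 eqy; elim/ltn_ind => n IH nN.
have: 0 <= (1 + mu) * y n.
  have := eqy n nN; rewrite big_ord_recl rbin0 mul1r subn0 => E.
  have -> : (1 + mu) * y n =
      g n - \sum_(i < n) rbin (- a) (lift ord0 i) * y (n - lift ord0 i)%N.
    by rewrite -E; ring.
  rewrite addr_ge0 ?g0 // -sumrN sumr_ge0 // => i _.
  rewrite -mulNr mulr_ge0 ?oppr_ge0 ?rbinN_le0 //; apply: IH.
    by rewrite /= /bump /= add1n ltn_subrL; case: n i {E nN} => [[]|].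
  by rewrite (leq_trans (leq_subr _ _)).
by rewrite pmulr_rge0 //; lra.
Qed.

(** * Euler's integral *)

(** Both sides are the rising product of n + 1 factors starting at x, divided
    by n!. *)
Lemma rbin_shift (R : numFieldType) (x : R) n :
  rbin x n * (x + n%:R) = x * rbin (x + 1) n.
Proof.
elim: n => [|n IH]; first by rewrite !rbin0 addr0 mul1r mulr1.
apply: (@mulfI _ n.+1%:R); first by rewrite pnatr_eq0.
rewrite mulrA rbinS mulrCA rbinS mulrCA -IH -natr1; ring.
Qed.

Lemma rbin_gt0 (R : numFieldType) (x : R) n : 0 < x -> 0 < rbin x n.
Proof.
by move=> x0; apply: prodr_gt0 => i _; rewrite divr_gt0 ?ltr0n // ltr_wpDr.
Qed.

Lemma bernoulli_le (R : realFieldType) (y : R) n :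
  0 <= y -> 1 + n%:R * y <= (1 + y) ^+ n.
Proof.
move=> y0; elim: n => [|n IH]; first by rewrite mul0r addr0 expr0.
rewrite exprS; apply: (@le_trans _ _ ((1 + y) * (1 + n%:R * y))).
  by rewrite -natr1; have := mulr_ge0 (mulr_ge0 (ler0n R n) y0) y0; nra.
by apply: ler_wpM2l IH; rewrite addr_ge0.
Qed.

Lemma powR_within_continuous (R : realType) (x r : R) : 0 <= x -> 0 < r ->
  {within `[0, r], continuous (fun t : R => t `^ x)}.
Proof.
move=> x0 r0.
have D (t : R) : 0 < t -> {for t, continuous (fun t : R => t `^ x)}.
  move=> t0; apply: differentiable_continuous; apply/derivable1_diffP.
  by apply: derivable_powR; rewrite in_itv /= t0.
apply/continuous_within_itvP => //; split.
- by move=> t; rewrite in_itv /= => /andP[t0 _]; exact: D.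
- move: x0; rewrite le_eqVlt => /predU1P[<-|x0].
    under eq_cvg do rewrite powRr0.
    by rewrite powRr0; exact: cvg_cst.
  by rewrite powR0 ?gt_eqF //; exact: powR_cvg0.
- by apply: cvg_at_left_filter; exact: D.
Qed.

Lemma near_infty_ltSr (R : realType) (x : R) :
  \forall n \near \oo, x < n.+1%:R.
Proof.
near=> n; rewrite -natr1; apply: (@le_lt_trans _ _ n%:R); last by rewrite ltrDl.
by near: n; exact: nbhs_infty_ger.
Unshelve. all: by end_near. Qed.

Section euler_integral.
Variable R : realType.
Notation mu := (@lebesgue_measure R).

Lemma Rintegral_powR (x r : R) : 0 <= x -> 0 < r ->
  \int[mu]_(t in `[0, r]) (t `^ x) = r `^ (x + 1) / (x + 1).
Proof.
move=> x0 r0; have x1 : 0 < x + 1 by rewrite ltr_wpDl.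
pose F (t : R) := t `^ (x + 1) / (x + 1).
have dF (t : R) : 0 < t -> is_derive t (1:R) F (t `^ x).
  move=> t0; have d := is_derive1_powR (x + 1) t0.
  have d' : is_derive t (1 : R) F ((x + 1)^-1 *: ((x + 1) * t `^ x)).
    have -> : F = (x + 1)^-1 *: (fun t => t `^ (x + 1)).
      by apply/funext => s; rewrite /F /= mulrC.
    by apply: is_deriveZ; rewrite -[X in _ `^ X](addrK 1 x).
  by apply: (is_derive_eq d'); rewrite /GRing.scale /= mulKf // gt_eqF.
have F0 : F 0 = 0 by rewrite /F powR0 ?gt_eqF // mul0r.
rewrite /Rintegral (@continuous_FTC2 _ _ F) //.
- by rewrite -EFinB F0 subr0.
- exact: powR_within_continuous.
- have /(continuous_within_itvP _ r0) [_ c0 cr] :=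
    powR_within_continuous (ltW x1) r0.
  split.
  + by move=> t; rewrite in_itv /= => /andP[t0 _]; case: (dF _ t0).
  + by apply: cvgMl.
  + by apply: cvgMl.
- by move=> t; rewrite in_itv /= => /andP[t0 _]; rewrite derive1E; case: (dF _ t0).
Qed.

Lemma euler_integrable (x r : R) m : 0 <= x -> 0 < r ->
  mu.-integrable `[0, r] (EFin \o (fun t => t `^ x * (1 - t / r) ^+ m)).
Proof.
move=> x0 r0; apply: continuous_compact_integrable; first exact: segment_compact.
have c : continuous (fun t : R => (1 - t / r) ^+ m).
  move=> t.
  apply: (@continuous_comp _ _ _ (fun t : R => 1 - t / r) (fun y : R => y ^+ m)).
    by apply: cvgB; [exact: cvg_cst|apply: cvgMl; exact: cvg_id].
  exact: exprn_continuous.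
move=> t; apply: cvgM; first exact: powR_within_continuous.
exact: (continuous_subspaceT c).
Qed.

(** The beta integral, by induction on m: expanding one factor 1 - t / r turns
    the integral for (x, m + 1) into the one for (x, m) minus 1 / r times the
    one for (x + 1, m). *)
Lemma euler_integral (x r : R) m : 0 <= x -> 0 < r ->
  \int[mu]_(t in `[0, r]) (t `^ x * (1 - t / r) ^+ m) =
  r `^ (x + 1) / ((x + 1 + m%:R) * rbin (x + 1) m).
Proof.
move=> + r0; elim: m x => [|m IH] x x0.
  rewrite rbin0 addr0 mulr1 -Rintegral_powR //.
  by apply: eq_Rintegral => t _; rewrite expr0 mulr1.
have x1 : 0 < x + 1 by rewrite ltr_wpDl.
have x10 : 0 <= x + 1 by apply: ltW.
transitivity (\int[mu]_(t in `[0, r])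
   (t `^ x * (1 - t / r) ^+ m - r^-1 * (t `^ (x + 1) * (1 - t / r) ^+ m))).
  apply: eq_Rintegral => t; rewrite inE /= in_itv /= => /andP[t0 _].
  rewrite powRD ?powRr1 ?(gt_eqF x1) // exprS; ring.
rewrite RintegralB //=; last 2 first.
- exact: euler_integrable.
- exact: (integrableZl _ r^-1 (euler_integrable m x10 r0)).
rewrite RintegralZl //; last exact: euler_integrable.
rewrite !IH // [r `^ (x + 1 + 1)]powRD ?(gt_eqF r0) ?implybT //.
rewrite powRr1; last exact: ltW.
have e1 := rbin_shift (x + 1) m; have e2 := rbinS (x + 1) m.
have P := rbin_gt0 m x1.
have m0 := ler0n R m.
have -> : rbin (x + 1 + 1) m = rbin (x + 1) m * (x + 1 + m%:R) / (x + 1).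
  by rewrite e1 mulrAC divff ?mul1r // gt_eqF.
have -> : rbin (x + 1) m.+1 = (x + 1 + m%:R) * rbin (x + 1) m / m.+1%:R.
  by rewrite -e2 mulrAC divff ?mul1r // pnatr_eq0.
rewrite -natr1; field.
by rewrite !gt_eqF //=; lra.
Qed.

(** The approximation (1 - t / N)^N of exp(- t), truncated at t = N, for
    N = n + 1. *)
Definition euler_kernel (n : nat) (t : R) : R :=
  if t <= n.+1%:R then (1 - t / n.+1%:R) ^+ n.+1 else 0.

Lemma euler_kernel_ge0 n (t : R) : 0 <= euler_kernel n t.
Proof.
rewrite /euler_kernel; case: ifP => // tn.
by rewrite exprn_ge0 // subr_ge0 ler_pdivrMr ?ltr0n // mul1r.
Qed.

(** For t < N, Bernoulli's inequality bounds the (N + 1)-st power of the ratio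
    of 1 - t / (N + 1) to 1 - t / N below by the inverse of 1 - t / N. *)
Lemma euler_kernel_nondecreasing (t : R) : 0 <= t ->
  {homo (fun n => euler_kernel n t) : m n / (m <= n)%N >-> m <= n}.
Proof.
move=> t0; apply/nondecreasing_seqP => n.
have := euler_kernel_ge0 n.+1 t; rewrite {2}/euler_kernel.
have n0 : 0 < n.+1%:R :> R by rewrite ltr0n.
case: ifP => // tn _.
rewrite /euler_kernel (le_trans tn) ?ler_nat //.
set N : R := n.+1%:R in n0 tn *.
have -> : n.+2%:R = N + 1 :> R by rewrite natr1.
have [->|neq_tN] := eqVneq t N.
  rewrite divff ?gt_eqF // subrr exprS mul0r exprn_ge0 // subr_ge0.
  by rewrite ler_pdivrMr; lra.
have {neq_tN}tn : t < N by rewrite lt_neqAle neq_tN.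
have q0 : 0 < 1 - t / N by rewrite subr_gt0 ltr_pdivrMr // mul1r.
have d0 : 0 < N - t by rewrite subr_gt0.
have y0 : 0 <= t / ((N + 1) * (N - t)).
  by rewrite divr_ge0 // mulr_ge0; lra.
have := bernoulli_le n.+2 y0.
have -> : 1 + t / ((N + 1) * (N - t)) = (1 - t / (N + 1)) / (1 - t / N).
  by field; rewrite !gt_eqF //=; lra.
have -> : 1 + n.+2%:R * (t / ((N + 1) * (N - t))) = (1 - t / N)^-1.
  by rewrite -natr1 -/N; field; rewrite !gt_eqF //=; lra.
rewrite expr_div_n ler_pdivlMr ?exprn_gt0 //.
by rewrite [X in _ * X]exprS mulKf ?gt_eqF.
Qed.

(** Squeezed between exp(- t - t^2 / (N - t)) and exp(- t), by applying
    1 + y <= exp y to y = - t / N and to y = t / (N - t). *)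
Lemma euler_kernel_cvg (t : R) : 0 <= t ->
  euler_kernel n t @[n --> \oo] --> expR (- t).
Proof.
move=> t0.
apply: (@squeeze_cvgr _ _ _ _ (fun n : nat => expR (- t - t ^+ 2 / (n.+1%:R - t)))
          (fun=> expR (- t))); last exact: cvg_cst.
- near=> n.
  have tn : t < n.+1%:R by near: n; exact: near_infty_ltSr.
  have n0 : 0 < n.+1%:R :> R by rewrite ltr0n.
  have d0 : 0 < n.+1%:R - t by rewrite subr_gt0.
  rewrite /euler_kernel (ltW tn).
  have q0 : 0 < 1 - t / n.+1%:R by rewrite subr_gt0 ltr_pdivrMr // mul1r.
  apply/andP; split; last first.
    have -> : - t = - (t / n.+1%:R) * n.+1%:R.
      by rewrite mulNr divfK // gt_eqF.
    by rewrite expRM_natr ler_pXn2r ?nnegrE ?expR_ge0 ?(ltW q0) // expR_ge1Dx.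
  have -> : - t - t ^+ 2 / (n.+1%:R - t) = - (t / (n.+1%:R - t)) * n.+1%:R.
    by field; rewrite nat1r gt_eqF.
  rewrite expRM_natr ler_pXn2r ?nnegrE ?expR_ge0 ?(ltW q0) //.
  rewrite expRN -[leRHS]invrK lef_pV2 ?posrE ?expR_gt0 ?invr_gt0 //.
  apply: le_trans (expR_ge1Dx _).
  by rewrite le_eqVlt; apply/orP; left; apply/eqP; field; rewrite !nat1r !gt_eqF.
- apply: (@continuous_cvg _ _ _ _ _ _ (@expR R)); first exact: continuous_expR.
  rewrite -[X in _ --> X]subr0; apply: cvgB; first exact: cvg_cst.
  rewrite -(mulr0 (t ^+ 2)); apply: cvgMr.
  apply/cvgr0Pnorm_lt => e e0; near=> n.
  have : e^-1 + t < n.+1%:R by near: n; exact: near_infty_ltSr.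
  rewrite -ltrBrDr => h; have i0 : 0 < e^-1 by rewrite invr_gt0.
  rewrite gtr0_norm ?invr_gt0 ?(lt_trans i0) //.
  by rewrite -[ltRHS]invrK ltf_pV2 ?posrE // (lt_trans i0).
Unshelve. all: by end_near. Qed.

End euler_integral.

(** * Gauss's product formula for the Gamma function *)

Lemma gauss_ratio_gt0 (R : realType) (x : R) n : 0 <= x ->
  0 < rbin (x + 1) n.+1 / n.+1%:R `^ x.
Proof.
by move=> x0; rewrite divr_gt0 ?powR_gt0 ?ltr0n // rbin_gt0 // ltr_wpDl.
Qed.

(** Passing from N to N + 1 multiplies the ratio by
    (1 + x / (N + 1)) (N / (N + 1))^x.  The first factor is at most
    exp(x / (N + 1)), the second at most exp(- x / (N + 1)). *)
Lemma gauss_ratio_nonincreasing (R : realType) (x : R) : 0 <= x ->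
  {homo (fun n => rbin (x + 1) n.+1 / n.+1%:R `^ x) :
     m n / (m <= n)%N >-> n <= m}.
Proof.
move=> x0; apply/nonincreasing_seqP => n.
set N : R := n.+1%:R; have N0 : 0 < N by rewrite ltr0n.
have N1 : 0 < N + 1 by rewrite addr_gt0.
have -> : n.+2%:R = N + 1 by rewrite natr1.
have -> : rbin (x + 1) n.+2 = (1 + x / (N + 1)) * rbin (x + 1) n.+1.
  apply: (@mulfI _ n.+2%:R); first by rewrite pnatr_eq0.
  rewrite rbinS -/N -natr1 -/N; field.
  by rewrite gt_eqF.
rewrite ler_pdivrMr ?powR_gt0 // [leRHS]mulrAC ler_pdivlMr ?powR_gt0 //.
have -> : (N + 1) `^ x = ((N + 1) / N) `^ x * N `^ x.
  by rewrite -powRM ?divfK ?gt_eqF // ?ltW // divr_gt0.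
rewrite mulrA ler_wpM2r ?powR_ge0 // [leLHS]mulrC ler_wpM2l //.
  by rewrite ltW // rbin_gt0 // ltr_wpDl.
apply: (le_trans (expR_ge1Dx _)).
have -> : expR (x / (N + 1)) = expR ((N + 1)^-1) `^ x.
  by rewrite /powR gt_eqF ?expR_gt0 // expRK.
apply: ge0_ler_powR; rewrite ?nnegrE ?expR_ge0 ?divr_ge0 ?(ltW N0) ?(ltW N1) //.
rewrite -[leLHS]invrK -expRN -[leRHS]invrK lef_pV2 ?posrE ?invr_gt0 ?divr_gt0 ?expR_gt0 //.
apply: le_trans (expR_ge1Dx _).
rewrite le_eqVlt; apply/orP; left; apply/eqP; field.
by rewrite !gt_eqF.
Qed.

Section gauss_limit.
Variables (R : realType) (x : R).
Hypothesis x0 : 0 <= x.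
Notation mu := (@lebesgue_measure R).

Let g (n : nat) : R :=
  n.+1%:R `^ (x + 1) / ((x + 1 + n.+1%:R) * rbin (x + 1) n.+1).

Let integral_euler_kernel n :
  (\int[mu]_(t in `]0%R, +oo[) (t `^ x * euler_kernel n t)%:E = (g n)%:E)%E.
Proof.
have n0 : 0 < n.+1%:R :> R by rewrite ltr0n.
have fi := euler_integrable n.+1 x0 n0.
rewrite /g -(euler_integral n.+1 x0 n0) /Rintegral fineK; last first.
  exact: integrable_fin_num.
transitivity (\int[mu]_(t in `]0%R, n.+1%:R])
    (t `^ x * (1 - t / n.+1%:R) ^+ n.+1)%:E)%E; last first.
  apply: integral_itv_obnd_cbnd.
  apply: (measurable_funS _ _ (measurable_int _ fi)) => //.
  by apply: subset_itvr; rewrite bnd_simp.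
have -> : `]0, n.+1%:R]%classic = `]0, +oo[ `&` `]-oo, n.+1%:R] :> set R.
  apply/seteqP; split => t /=; rewrite !in_itv /=; first by move/andP => [-> ->].
  by rewrite andbT => -[-> ->].
rewrite integral_mkcondr; apply: eq_integral => t _.
rewrite /patch /euler_kernel mem_setE in_itv /=; case: ifP => // _.
by rewrite mulr0.
Qed.

Let I : \bar R := (\int[mu]_(t in `]0%R, +oo[) (t `^ x * expR (- t))%:E)%E.

Let g_cvg : ((g n)%:E @[n --> \oo] --> I)%E.
Proof.
under eq_cvg do rewrite -integral_euler_kernel.
have E : I = (\int[mu]_(t in `]0%R, +oo[)
    limn (fun n => (t `^ x * euler_kernel n t)%:E))%E.
  apply: eq_integral => t; rewrite inE /= in_itv /= andbT => t0.
  apply/esym/cvg_lim => //; apply: cvg_EFin; first exact: nearW.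
  by apply: cvgMr; apply: euler_kernel_cvg; exact: ltW.
rewrite E; apply: cvg_monotone_convergence => //.
- move=> n; apply/measurable_EFinP; apply: measurable_funM.
    by apply: measurable_funTS; exact: measurable_powR.
  apply: measurable_funTS; apply: measurable_fun_ifT => //.
    exact: measurable_fun_ler.
  apply: measurable_funX; apply: measurable_funB => //.
  exact: measurable_funM.
- by move=> n t _; rewrite lee_fin mulr_ge0 ?powR_ge0 ?euler_kernel_ge0.
- move=> t; rewrite /= in_itv /= andbT => t0 m n mn.
  by rewrite lee_fin ler_wpM2l ?powR_ge0 // euler_kernel_nondecreasing // ltW.
Qed.

(** The integral of t^x against [euler_kernel] tends to Gamma(x + 1) by
    monotone convergence; by [euler_integral] its product with the ratio on the
    left is N / (x + 1 + N) with N = n + 1, which tends to 1. *)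
Lemma gauss_limit :
  rbin (x + 1) n.+1 / n.+1%:R `^ x @[n --> \oo] --> (Gamma (x + 1))^-1.
Proof.
have GE : Gamma (x + 1) = fine I by rewrite /Gamma /I addrK.
pose c n : R := rbin (x + 1) n.+1 / n.+1%:R `^ x.
have c0 n : 0 < c n by exact: gauss_ratio_gt0.
have x1 : 0 < x + 1 by rewrite ltr_wpDl.
have cg n : c n * g n = n.+1%:R / (x + 1 + n.+1%:R).
  have N0 : 0 < n.+1%:R :> R by rewrite ltr0n.
  rewrite /c /g powRD ?(gt_eqF N0) ?implybT // powRr1 ?ltW //.
  set N : R := n.+1%:R in N0 *; set P := rbin _ _; set q := N `^ x.
  have P0 : 0 < P by rewrite rbin_gt0.
  have q0 : 0 < q by rewrite powR_gt0.
  field; rewrite !gt_eqF //; lra.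
have cg1 n : c n * g n <= 1.
  by rewrite cg ler_pdivrMr ?mul1r ?lerDr ?ltW // ltr_pwDl // ltW.
have cgl : c n * g n @[n --> \oo] --> (1 : R).
  under eq_cvg do rewrite cg.
  apply/cvgrPdist_le => e e0; near=> n.
  have : (x + 1) / e < n.+1%:R by near: n; exact: near_infty_ltSr.
  have N0 : 0 < n.+1%:R :> R by rewrite ltr0n.
  set N : R := n.+1%:R in N0 * => h.
  have -> : 1 - N / (x + 1 + N) = (x + 1) / (x + 1 + N).
    by field; rewrite gt_eqF //; lra.
  have d0 : 0 < x + 1 + N by rewrite addr_gt0.
  rewrite ger0_norm ?divr_ge0 ?ltW // ltr_pdivrMr // mulrC -ltr_pdivrMr //.
  by rewrite (lt_trans h) // ltrDr.
have : (0 <= I)%E.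
  by apply: integral_ge0 => t _; rewrite lee_fin mulr_ge0 ?powR_ge0 ?expR_ge0.
rewrite GE; case: I g_cvg => [r| |] //= gl _.
- have gr : g n @[n --> \oo] --> r by exact: (fine_cvg gl).
  have cc : cvgn c.
    apply: nonincreasing_is_cvgn; first exact: gauss_ratio_nonincreasing.
    by exists 0 => _ [n _ <-]; exact: ltW.
  have l1 : limn c * r = 1.
    by apply: (@cvg_unique _ (@Rhausdorff R) _ _ _ _ _ cgl); apply: cvgM.
  have r0 : r != 0 by apply/eqP => r0; move: l1; rewrite r0 mulr0; lra.
  have -> : r^-1 = limn c by apply: (mulIf r0); rewrite mulVf.
  exact: cc.
(* An infinite I gives Gamma (x + 1) the default value 0, with inverse 0: the
   formula also holds in this case, as c n <= (g n)^-1 tends to 0. *)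
- rewrite invr0; apply/cvgr0Pnorm_lt => e e0; near=> n.
  have : e^-1 < g n.
    by rewrite -lte_fin; near: n; move/cvgeyPgt: gl => /(_ e^-1).
  rewrite gtr0_norm ?c0 // => h.
  have g0 : 0 < g n by rewrite (lt_trans _ h) // invr_gt0.
  have : c n <= (g n)^-1 by rewrite -[leRHS]mul1r ler_pdivlMr.
  move/le_lt_trans; apply.
  by rewrite -[ltRHS]invrK ltf_pV2 ?posrE ?invr_gt0.
Unshelve. all: by end_near. Qed.

End gauss_limit.

(** * A discrete Mittag-Leffler function *)

Lemma cvg_series_pointwise (R : realType) (f : nat -> nat -> R) (l : nat -> R) K :
  (forall k, f n k @[n --> \oo] --> l k) ->
  series (f n) K @[n --> \oo] --> series l K.
Proof.
move=> fl; elim: K => [|K IH].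
  rewrite /series /= big_geq //.
  by under eq_cvg do rewrite big_geq //; exact: cvg_cst.
rewrite seriesSr; under eq_cvg do rewrite seriesSr.
exact: cvgD.
Qed.

Lemma normed_series_le_cvg (R : realType) (f M : nat -> R) :
  cvgn (series M) -> (forall k, `|f k| <= M k) -> cvgn [normed series f].
Proof.
move=> cM fM; apply: (series_le_cvg _ _ fM cM) => // k.
exact: le_trans (fM k).
Qed.

(** The differences of corresponding terms are at most 2 M k, so the tails are
    uniformly small and only finitely many terms matter. *)
Lemma tannery (R : realType) (f : nat -> nat -> R) (l M : nat -> R) :
  cvgn (series M) ->
  (\forall n \near \oo, forall k, `|f n k| <= M k) ->
  (forall k, f n k @[n --> \oo] --> l k) ->
  limn (series (f n)) @[n --> \oo] --> limn (series l).
Proof.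
move=> cM fM fl.
have lM k : `|l k| <= M k.
  apply: (cvgr_to_le (cvg_norm (fl k))).
  by near=> n; have : forall k, `|f n k| <= M k by near: n.
have M0 k : 0 <= M k by exact: le_trans (lM k).
have cl := normed_series_le_cvg cM lM.
apply/cvgrPdist_le => e e0.
have e40 : 0 < e / 4 by rewrite divr_gt0.
have [K _ MK] : \forall K \near \oo, `|limn (series M) - series M K| <= e / 4.
  by move/cvgrPdist_le: cM; apply.
have {MK} MK : limn (series M) - series M K <= e / 4.
  exact: le_trans (ler_norm _) (MK K (leqnn K)).
have := @cvg_series_pointwise R (fun n k => `|l k - f n k|) (fun=> 0) K.
have dl k : `|l k - f n k| @[n --> \oo] --> (0 : R).
  rewrite -(normr0 R) -(subrr (l k)); apply: cvg_norm.
  by apply: cvgB; [exact: cvg_cst|exact: fl].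
move=> /(_ dl); have -> : series (fun=> 0 : R) K = 0 by rewrite /series /= big1.
move/cvgr0Pnorm_le => /(_ (e / 2)); rewrite divr_gt0 // => /(_ isT) near_d.
near=> n.
have fnM : forall k, `|f n k| <= M k by near: n.
have cf := normed_series_le_cvg cM fnM.
rewrite -lim_seriesB; [|exact: normed_cvg..].
have dM k : `|(l - f n) k| <= 2 * M k.
  apply: (le_trans (ler_normB _ _)).
    by have := lM k; have := fnM k; lra.
have cd : cvgn [normed series (l - f n)].
  by apply: normed_series_le_cvg dM; exact: (is_cvg_seriesZ (k := 2) cM).
apply: (le_trans (lim_series_norm cd)).
apply: limr_le => //; near=> m.
have Km : (K <= m)%N by near: m; exact: nbhs_infty_ge.
have dn : series (fun k => `|l k - f n k|) K <= e / 2.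
  by apply: le_trans (ler_norm _) _; near: n.
have MmK : series M m - series M K <= e / 4.
  apply: le_trans MK; rewrite lerD2r nondecreasing_cvgn_le //.
  exact: nondecreasing_series.
rewrite /series /= in dn MmK.
change (\sum_(0 <= k < m) `|(l - f n) k| <= e).
rewrite (big_cat_nat _ (n := K)) //=.
rewrite [X in X - _](big_cat_nat _ (n := K)) //= addrAC subrr add0r in MmK.
have : \sum_(K <= k < m) `|(l - f n) k| <= 2 * \sum_(K <= k < m) M k.
  by rewrite mulr_sumr; apply: ler_sum => k _; exact: dM.
move: dn; set A := \sum_(_ <= _ < _) _; set B := \sum_(_ <= _ < _) _.
rewrite -/A; lra.
Unshelve. all: by end_near. Qed.

Section discrete_mittag_leffler.
Variables (R : realType) (a : R).
Hypotheses (a0 : 0 <= a) (a1 : a <= 1).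

Definition discrete_ml_term (mu : R) (n k : nat) : R :=
  (- mu) ^+ k * rbin (k%:R * a + 1) n.

(** The coefficient of z^n in (1 - z)^(a - 1) / ((1 - z)^a + mu), expanded in
    powers of mu (1 - z)^(- a). *)
Definition discrete_ml (mu : R) (n : nat) : R :=
  limn (series (discrete_ml_term mu n)).

Lemma discrete_ml_term_homo mu m n k : 0 <= mu -> (m <= n)%N ->
  `|discrete_ml_term mu m k| <= `|discrete_ml_term mu n k|.
Proof.
move=> mu0 mn; rewrite !normrM ler_wpM2l //.
have ka : 0 <= k%:R * a by rewrite mulr_ge0.
by rewrite !ger0_norm ?rbin_ge0 ?addr_ge0 // rbin_homo // lerDr.
Qed.

(** Convolving with the coefficients of (1 - z)^a shifts the exponents
    - k a - 1 of the series by a, so that the sum telescopes against mu times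
    itself and leaves the coefficient of (1 - z)^(a - 1). *)
Lemma discrete_ml_relaxation mu N n : 0 <= mu ->
  cvgn [normed series (discrete_ml_term mu N)] -> (n <= N)%N ->
  \sum_(i < n.+1) rbin (- a) i * discrete_ml mu (n - i)%N + mu * discrete_ml mu n
  = rbin (1 - a) n.
Proof.
move=> mu0 cN nN.
have c j : (j <= N)%N -> series (discrete_ml_term mu j) K @[K --> \oo] --> discrete_ml mu j.
  move=> jN; apply: normed_cvg; apply: (normed_series_le_cvg cN) => k.
  exact: discrete_ml_term_homo.
have S K : \sum_(i < n.+1) rbin (- a) i * series (discrete_ml_term mu (n - i)) K.+1
    + mu * series (discrete_ml_term mu n) K = rbin (1 - a) n.
  have -> : \sum_(i < n.+1) rbin (- a) i * series (discrete_ml_term mu (n - i)) K.+1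
     = \sum_(0 <= k < K.+1) (- mu) ^+ k * rbin (k%:R * a + 1 - a) n.
    under eq_bigr do rewrite /series /= mulr_sumr.
    rewrite exchange_big; apply: eq_bigr => k _.
    rewrite [_ + 1 - a]addrC -rbin_vandermonde mulr_sumr; apply: eq_bigr => i _.
    by rewrite /discrete_ml_term mulrCA.
  rewrite big_nat_recl //= expr0 mul1r mul0r add0r /series /= mulr_sumr.
  rewrite -addrA -big_split /= big1 ?addr0 // => k _.
  rewrite /discrete_ml_term exprS.
  have -> : k.+1%:R * a + 1 - a = k%:R * a + 1 by rewrite -natr1; ring.
  ring.
suff : \sum_(i < n.+1) rbin (- a) i * series (discrete_ml_term mu (n - i)) K.+1
    + mu * series (discrete_ml_term mu n) K @[K --> \oo] -->
  \sum_(i < n.+1) rbin (- a) i * discrete_ml mu (n - i)%N + mu * discrete_ml mu n.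
  move=> /cvg_lim <- //; under eq_fun do rewrite S.
  exact: lim_cst.
apply: cvgD; last by apply: cvgMr; exact: c.
apply: cvg_big => [|i _]; first exact: add_continuous.
apply: cvgMr; rewrite (cvg_shiftS (series (discrete_ml_term mu (n - i)))).
by apply: c; rewrite (leq_trans (leq_subr _ _)).
Qed.

Lemma discrete_ml_ge0 mu N : 0 <= mu ->
  cvgn [normed series (discrete_ml_term mu N)] -> 0 <= discrete_ml mu N.
Proof.
move=> mu0 cN.
apply: (@relaxation_ge0 _ a mu (rbin (1 - a)) _ N) => // n nN.
  by rewrite rbin_ge0 // subr_ge0.
exact: discrete_ml_relaxation cN nN.
Qed.

(** The difference for mu and nu satisfies the relaxation equation with
    parameter mu and right-hand side nu - mu times the nonnegative solution for
    nu. *)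
Lemma discrete_ml_nonincreasing mu nu N : 0 <= mu -> mu <= nu ->
  cvgn [normed series (discrete_ml_term nu N)] ->
  discrete_ml nu N <= discrete_ml mu N.
Proof.
move=> mu0 mu_nu cN; have nu0 := le_trans mu0 mu_nu.
have sub_term m n k : (m <= n)%N ->
    `|discrete_ml_term mu m k| <= `|discrete_ml_term nu n k|.
  move=> /(discrete_ml_term_homo k mu0) /le_trans; apply.
  by rewrite !normrM ler_wpM2r // !normrX !normrN lerXn2r ?nnegrE // !ger0_norm.
have cM : cvgn [normed series (discrete_ml_term mu N)].
  by apply: (normed_series_le_cvg cN) => k; exact: sub_term.
rewrite -subr_ge0.
apply: (@relaxation_ge0 _ a mu (fun n => (nu - mu) * discrete_ml nu n)
  (fun n => discrete_ml mu n - discrete_ml nu n) N) => // n nN.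
  rewrite mulr_ge0 ?subr_ge0 // discrete_ml_ge0 //.
  by apply: (normed_series_le_cvg cN) => k; exact: discrete_ml_term_homo.
have := discrete_ml_relaxation mu0 cM nN.
rewrite -(discrete_ml_relaxation nu0 cN nN) => /eqP.
rewrite -subr_eq0 => /eqP E.
under eq_bigr do rewrite mulrBr; rewrite sumrB.
by apply/eqP; rewrite -subr_eq0 -[X in _ == X]E; apply/eqP; ring.
Qed.

End discrete_mittag_leffler.

(** * Monotonicity of the Mittag-Leffler function *)

Section mittag_leffler_monotone.
Variables (R : realType) (a : R).
Hypotheses (a0 : 0 < a) (a1 : a <= 1).

(** Each of the m + 1 factors is at most 1 + k, hence at most
    (m + 1) (1 + k / (m + 1)) <= (m + 1) exp(k / (m + 1)). *)
Lemma rbin_le_expR (y : R) m (k : nat) : 0 <= y -> y <= k%:R ->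
  rbin (y + 1) m.+1 <= m.+1%:R ^+ m.+1 * expR 1 ^+ k.
Proof.
move=> y0 yk; have m0 : 0 < m.+1%:R :> R by rewrite ltr0n.
have -> : expR 1 ^+ k = expR (k%:R / m.+1%:R) ^+ m.+1 :> R.
  by rewrite -!expRM_natr mul1r divfK // gt_eqF.
rewrite -exprMn.
have -> : (m.+1%:R * expR (k%:R / m.+1%:R)) ^+ m.+1 =
    \prod_(i < m.+1) (m.+1%:R * expR (k%:R / m.+1%:R) : R).
  by rewrite big_const_ord iter_mulr_1.
apply: ler_prod => i _; apply/andP; split.
  by rewrite divr_ge0 // !addr_ge0.
apply: (@le_trans _ _ (1 + k%:R)).
  rewrite ler_pdivrMr ?ltr0n // -natr1.
  have : 0 <= k%:R * (i%:R : R) by rewrite mulr_ge0.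
  by have := ler0n R i; nra.
apply: (@le_trans _ _ (m.+1%:R * (1 + k%:R / m.+1%:R))).
  by rewrite mulrDr mulr1 mulrCA divff ?gt_eqF // mulr1 lerD2r ler1n.
by rewrite ler_pM2l // expR_ge1Dx.
Qed.

Let b (n k : nat) : R := rbin (k%:R * a + 1) n.+1 / n.+1%:R `^ (k%:R * a).

Let discrete_ml_termE x n k :
  discrete_ml_term a (x / n.+1%:R `^ a) n.+1 k = (- x) ^+ k * b n k.
Proof.
rewrite /discrete_ml_term /b -mulNr exprMn -mulrA; congr (_ * _).
by rewrite mulrC [k%:R * a]mulrC powRrM powR_mulrn ?powR_ge0 // exprVn.
Qed.

(** By [gauss_ratio_nonincreasing] the k-th term for n >= N is at most the one
    for N, which [rbin_le_expR] bounds by the k-th term of a geometric series of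
    ratio e x / (N + 1)^a. *)
Lemma mittag_leffler_dominated (x : R) : 0 <= x ->
  exists M : nat -> R, cvgn (series M) /\
    \forall n \near \oo, forall k,
      `|discrete_ml_term a (x / n.+1%:R `^ a) n.+1 k| <= M k.
Proof.
move=> x0; have ka k : 0 <= k%:R * a by rewrite mulr_ge0 // ltW.
have ex0 : 0 <= expR 1 * x by rewrite mulr_ge0 ?expR_ge0.
(* N is chosen so that (N + 1)^a > e x. *)
have [N _ NP] := near_infty_ltSr ((expR 1 * x) `^ a^-1).
have {NP} NP : expR 1 * x < N.+1%:R `^ a.
  have := gt0_ltr_powR a0 _ _ (NP N (leqnn N)).
  by rewrite -powRrM mulVf ?gt_eqF // powRr1 // !nnegrE powR_ge0 //; apply.
set q := N.+1%:R `^ a in NP; have q0 : 0 < q by rewrite powR_gt0 ?ltr0n.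
exists (geometric (N.+1%:R ^+ N.+1) (expR 1 * x / q)); split.
  apply: is_cvg_geometric_series.
  by rewrite ger0_norm ?divr_ge0 ?(ltW q0) // ltr_pdivrMr // mul1r.
exists N => // n /= Nn k.
have n0 : 0 < n.+1%:R :> R by rewrite ltr0n.
rewrite discrete_ml_termE normrM normrX normrN (ger0_norm x0).
rewrite [X in _ * X]ger0_norm; last by apply: ltW; rewrite /b; exact: gauss_ratio_gt0.
apply: (@le_trans _ _ (x ^+ k * b N k)).
  by apply: ler_wpM2l; [exact: exprn_ge0|exact: gauss_ratio_nonincreasing].
have -> : b N k = rbin (k%:R * a + 1) N.+1 / q ^+ k.
  by rewrite /b [k%:R * a]mulrC powRrM powR_mulrn ?powR_ge0.
rewrite /geometric /= expr_div_n exprMn mulrA mulrA.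
rewrite ler_wpM2r ?invr_ge0 ?exprn_ge0 ?(ltW q0) // mulrC mulrA.
rewrite ler_wpM2r ?exprn_ge0 //; apply: rbin_le_expR => //.
by rewrite -[leRHS]mulr1 ler_wpM2l.
Qed.

Lemma discrete_ml_cvg (x : R) : 0 <= x ->
  discrete_ml a (x / n.+1%:R `^ a) n.+1 @[n --> \oo] --> mittag_leffler a (- x).
Proof.
move=> x0; have [M [cM dM]] := mittag_leffler_dominated x0.
apply: (tannery cM dM) => k.
have ka : 0 <= k%:R * a by rewrite mulr_ge0 // ltW.
by under eq_cvg do rewrite discrete_ml_termE; apply: cvgMr; exact: gauss_limit.
Qed.

Lemma near_discrete_ml_summable (x : R) : 0 <= x ->
  \forall n \near \oo,
    cvgn [normed series (discrete_ml_term a (x / n.+1%:R `^ a) n.+1)].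
Proof.
move=> x0; have [M [cM dM]] := mittag_leffler_dominated x0.
by apply: filterS dM => n; exact: normed_series_le_cvg.
Qed.

Lemma mittag_leffler_ge0 (x : R) : 0 <= x -> 0 <= mittag_leffler a (- x).
Proof.
move=> x0; apply: (cvgr_to_ge (discrete_ml_cvg x0)).
apply: filterS (near_discrete_ml_summable x0) => n.
by apply: discrete_ml_ge0; rewrite ?(ltW a0) // divr_ge0 ?powR_ge0.
Qed.

Lemma mittag_leffler_nonincreasing (x y : R) : 0 <= x -> x <= y ->
  mittag_leffler a (- y) <= mittag_leffler a (- x).
Proof.
move=> x0 xy; have y0 := le_trans x0 xy.
apply: (ler_cvg_to (discrete_ml_cvg y0) (discrete_ml_cvg x0)).
apply: filterS (near_discrete_ml_summable y0) => n.
apply: discrete_ml_nonincreasing; rewrite ?(ltW a0) ?divr_ge0 ?powR_ge0 //.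
by rewrite ler_wpM2r ?invr_ge0 ?powR_ge0.
Qed.

End mittag_leffler_monotone.

(** * A C^1 step function *)

Section smoothstep.
Variable R : realType.
Implicit Types x t : R.

Definition ramp x : R := Num.max x 0.

Lemma ramp_le0 x : x <= 0 -> ramp x = 0.
Proof. exact: max_r. Qed.

Lemma ramp_ge0 x : 0 <= x -> ramp x = x.
Proof. exact: max_l. Qed.

(** The difference quotient at x differs from 2 [ramp] x by at most |h|, with no
    distinction of cases at the kink. *)
Lemma ramp_sqr_is_derive x : is_derive x (1:R) (fun y => ramp y ^+ 2) (2 * ramp x).
Proof.
suff d : h^-1 *: (((fun y => ramp y ^+ 2) \o shift x) (h *: (1:R)) - ramp x ^+ 2)
    @[h --> 0^'] --> 2 * ramp x.
  by apply: DeriveDef; [apply/cvg_ex; exists (2 * ramp x)|exact/cvg_lim].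
apply/cvgrPdist_le => e e0; near=> h.
have h0 : h != 0 by near: h; exact: nbhs_dnbhs_neq.
have he : `|h| <= e.
  near: h; apply: nbhs_dnbhs; apply/nbhs_ballP; exists e => //= y.
  by rewrite /ball /= sub0r normrN => /ltW.
rewrite /= /GRing.scale /= mulr1.
have -> : 2 * ramp x - h^-1 * (ramp (h + x) ^+ 2 - ramp x ^+ 2) =
   - (h^-1 * (ramp (h + x) ^+ 2 - ramp x ^+ 2 - 2 * ramp x * h)) by field.
rewrite normrN normrM normfV ler_pdivrMl ?normr_gt0 //.
apply: (@le_trans _ _ (`|h| * `|h|)); last by rewrite ler_wpM2l.
rewrite -normrM [leRHS]ger0_norm; last by rewrite -expr2 sqr_ge0.
rewrite /ramp /Num.max ler_norml.
by case: ltP => ?; case: ltP => ?; apply/andP; split; nra.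
Unshelve. all: by end_near. Qed.

(** The linear B-spline with nodes 0, 1, 2; [smoothstep] is its primitive. *)
Definition hat x : R := ramp x - 2 * ramp (x - 1) + ramp (x - 2).

Definition smoothstep x : R :=
  (ramp x ^+ 2 - 2 * ramp (x - 1) ^+ 2 + ramp (x - 2) ^+ 2) / 2.

Lemma hat_ge0 x : 0 <= hat x.
Proof.
by rewrite /hat /ramp /Num.max; case: ltP => ?; case: ltP => ?; case: ltP => ?; lra.
Qed.

Lemma hat_supp x : x <= 0 \/ 2 <= x -> hat x = 0.
Proof.
by case=> x0; rewrite /hat; [rewrite !ramp_le0|rewrite !ramp_ge0]; lra.
Qed.

Lemma hat_continuous : continuous hat.
Proof.
have r (c : R) : continuous (fun t => ramp (t - c)).
  move=> t; apply: (@continuous_max _ _ (fun t => t - c) (cst 0)).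
    by apply: cvgB; [exact: cvg_id|exact: cvg_cst].
  exact: cvg_cst.
move=> t; apply: cvgD; last exact: r.
apply: cvgB; last by apply: cvgMr; exact: r.
by have := r 0 t; under eq_fun do rewrite subr0.
Qed.

Lemma smoothstep_eq0 x : x <= 0 -> smoothstep x = 0.
Proof. by move=> x0; rewrite /smoothstep !ramp_le0; lra. Qed.

Lemma smoothstep_eq1 x : 2 <= x -> smoothstep x = 1.
Proof. by move=> x2; rewrite /smoothstep !ramp_ge0; lra. Qed.

Lemma smoothstep_itv x : 0 <= smoothstep x <= 1.
Proof.
by rewrite /smoothstep /ramp /Num.max;
  case: ltP => ?; case: ltP => ?; case: ltP => ?; apply/andP; split; try nra.
Qed.

Lemma scaled_smoothstep_is_derive (N c t : R) :
  is_derive t (1 : R) (fun s => smoothstep (N * (s - c))) (N * hat (N * (t - c))).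
Proof.
have r (b : R) : is_derive t (1 : R) (fun s => ramp (N * (s - c) - b) ^+ 2)
    (N * (2 * ramp (N * (t - c) - b))).
  have d : is_derive t (1 : R) (fun s => N * (s - c) - b) N.
    by apply: is_derive_eq; rewrite /GRing.scale /=; ring.
  have := @is_derive1_comp R (fun y => ramp y ^+ 2) (fun s => N * (s - c) - b)
    t _ _ (ramp_sqr_is_derive _) d.
  by rewrite mulrC.
have r0 := r 0; have r1 := r 1; have r2 := r 2.
have d := is_deriveZ 2^-1 (is_deriveD (is_deriveB r0 (is_deriveZ 2 r1)) r2).
have -> : (fun s => smoothstep (N * (s - c))) = 2^-1 *:
  ((fun s => ramp (N * (s - c) - 0) ^+ 2) -
    2 *: (fun s => ramp (N * (s - c) - 1) ^+ 2) +
    (fun s => ramp (N * (s - c) - 2) ^+ 2)).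
  by apply/funext => s; rewrite /smoothstep !fctE /GRing.scale /= subr0 mulrC.
apply: (is_derive_eq d); rewrite /GRing.scale /= /hat !subr0; lra.
Qed.

End smoothstep.

(** * Increments of a function with an integrable weak derivative *)

Lemma Rintegral_itv_oo_cc (R : realType) (a b : R) (f : R -> R) :
  measurable_fun `]a, b[ f ->
  \int[@lebesgue_measure R]_(x in `]a, b[) f x =
  \int[@lebesgue_measure R]_(x in `[a, b]) f x.
Proof.
move=> mf; rewrite /Rintegral integral_itv_bndo_bndc; last exact/measurable_EFinP.
rewrite integral_itv_obnd_cbnd //.
exact/measurable_EFinP/measurable_fun_itv_bndo_bndcP.
Qed.

Section weak_derivative_ftc.
Variables (R : realType) (T : R) (u g : R -> R).
Notation mu := (@lebesgue_measure R).
Hypothesis T0 : 0 < T.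
Hypothesis u_cont : {within `[0, T], continuous u}.

Let k (n : nat) (c t : R) : R := n.+1%:R * hat (n.+1%:R * (t - c)).
Let psi (n : nat) (c t : R) : R := smoothstep (n.+1%:R * (t - c)).

Let k_continuous n c : continuous (k n c).
Proof.
move=> t; apply: cvgMr.
apply: (@continuous_comp _ _ _ (fun t => n.+1%:R * (t - c)) (@hat R)).
  by apply: cvgMr; apply: cvgB; [exact: cvg_id|exact: cvg_cst].
exact: hat_continuous.
Qed.

Let psi_derive n c t : is_derive t (1 : R) (psi n c) (k n c t).
Proof. exact: scaled_smoothstep_is_derive. Qed.

Let psi_continuous n c : continuous (psi n c).
Proof.
move=> t; apply: differentiable_continuous; apply/derivable1_diffP.
by case: (psi_derive n c t).
Qed.

Let k_ge0 n c t : 0 <= k n c t.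
Proof. by rewrite mulr_ge0 // hat_ge0. Qed.

Let k_integral c : 0 < c -> c < T ->
  \forall n \near \oo, \int[mu]_(t in `[0, T]) k n c t = 1.
Proof.
move=> c0 cT; near=> n.
have N0 : 0 < n.+1%:R :> R by rewrite ltr0n.
have Nc : 2 <= n.+1%:R * (T - c).
  rewrite -ler_pdivrMr ?subr_gt0 // ltW //; near: n; exact: near_infty_ltSr.
have psi0 : psi n c 0 = 0.
  by rewrite /psi smoothstep_eq0 // sub0r mulrN oppr_le0 mulr_ge0 ?ltW.
have psiT : psi n c T = 1 by rewrite /psi smoothstep_eq1.
rewrite /Rintegral (@continuous_FTC2 _ _ (psi n c)) //.
- by rewrite psi0 psiT -EFinB subr0.
- exact/continuous_subspaceT/k_continuous.
- split.
  + by move=> t _; case: (psi_derive n c t).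
  + exact/cvg_at_right_filter/psi_continuous.
  + exact/cvg_at_left_filter/psi_continuous.
- by move=> t _; rewrite derive1E; case: (psi_derive n c t).
Unshelve. all: by end_near. Qed.

Let uk_integrable (h : R -> R) n c : {within `[0, T], continuous h} ->
  mu.-integrable `[0, T] (EFin \o (fun t => h t * k n c t)).
Proof.
move=> hc; apply: continuous_compact_integrable; first exact: segment_compact.
move=> t; apply: cvgM; first exact: hc.
exact: (continuous_subspaceT (@k_continuous n c)).
Qed.

(** The weights n.+1 hat(n.+1 (t - c)) are nonnegative, of integral 1, and
    carried by [c, c + 2 / n.+1]. *)
Lemma mollifier_cvg c : 0 < c -> c < T ->
  \int[mu]_(t in `]0, T[) (u t * k n c t) @[n --> \oo] --> u c.
Proof.
move=> c0 cT.
have uc : u t @[t --> c] --> u c.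
  have /(continuous_within_itvP _ T0) [+ _ _] := u_cont.
  by move/(_ c); apply; rewrite in_itv /= c0.
apply/cvgrPdist_le => e e0.
move/cvgrPdist_le: uc => /(_ e e0) /nbhs_ballP [d /= d0 ud].
near=> n.
have N0 : 0 < n.+1%:R :> R by rewrite ltr0n.
have dN : 2 / n.+1%:R < d.
  rewrite ltr_pdivrMr // mulrC -ltr_pdivrMr //; near: n; exact: near_infty_ltSr.
have k1 : \int[mu]_(t in `[0, T]) k n c t = 1 by near: n; exact: k_integral.
have ci : {within `[0, T], continuous (fun=> u c : R)}.
  by move=> t; exact: cvg_cst.
have ki : mu.-integrable `[0, T] (EFin \o k n c).
  apply: continuous_compact_integrable; first exact: segment_compact.
  exact/continuous_subspaceT/k_continuous.
rewrite Rintegral_itv_oo_cc; last first.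
  have /integrableP[/measurable_EFinP mf _] := uk_integrable n c u_cont.
  by apply: measurable_funS mf => //; exact: subset_itv_oo_cc.
rewrite -[X in `|X - _|]mulr1 -k1 -RintegralZl // -RintegralB //; last 2 first.
- exact: uk_integrable.
- exact: uk_integrable.
have di : mu.-integrable `[0, T] (EFin \o (fun t => u c * k n c t - u t * k n c t)).
  apply: eq_integrable (integrableB _ (uk_integrable n c ci) (uk_integrable n c u_cont)) => //.
apply: (le_trans (le_normr_Rintegral _ di)) => //.
rewrite -[leRHS]mulr1 -k1 -RintegralZl //.
apply: le_Rintegral => //.
- exact: integrable_norm di.
- exact: integrableZl ki.
move=> t _; rewrite -mulrBl normrM [X in _ * X]ger0_norm ?k_ge0 //.
have [/andP[tc1 tc2]|tc] := boolP (c < t < c + 2 / n.+1%:R).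
  rewrite ler_wpM2r ?k_ge0 //; apply: ud.
  rewrite /ball /= ltr_norml; apply/andP; split; [|lra].
  by move: tc2 dN; set q := 2 / _; lra.
suff -> : k n c t = 0 by rewrite !mulr0.
rewrite /k hat_supp ?mulr0 //; move: tc; rewrite negb_and -!leNgt => /orP[tc|tc].
  by left; rewrite pmulr_rle0 // subr_le0.
by right; rewrite mulrC -ler_pdivrMr // lerBrDl.
Unshelve. all: by end_near. Qed.

Hypothesis gi : mu.-integrable setT (EFin \o g).
Hypothesis ug : weak_derivative T u g.

Let bump_test n x y : 0 < x -> x < y -> y + 2 / n.+1%:R < T ->
  test_function T (fun t => psi n x t - psi n y t).
Proof.
move=> x0 xy yT.
have N0 : 0 < n.+1%:R :> R by rewrite ltr0n.
have d t : is_derive t (1 : R) (fun t => psi n x t - psi n y t) (k n x t - k n y t).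
  by apply: is_deriveB.
split.
- by move=> t; case: (d t).
- have -> : derive1 (fun t => psi n x t - psi n y t) = fun t => k n x t - k n y t.
    by apply/funext => t; rewrite derive1E; case: (d t).
  by move=> t; apply: cvgB; exact: k_continuous.
- exists `[x, y + 2 / n.+1%:R]%classic; split; first exact: segment_compact.
    move=> t /=; rewrite !in_itv /= => /andP[xt ty].
    by rewrite (lt_le_trans x0 xt) (le_lt_trans ty yT).
  move=> t /=; rewrite in_itv /= => /negP; rewrite negb_and -!ltNge => /orP[tx|ty].
    rewrite /psi !smoothstep_eq0 ?subrr // pmulr_rle0 // subr_le0 ltW //.
    exact: lt_trans xy.
  have yt : 2 <= n.+1%:R * (t - y) by rewrite mulrC -ler_pdivrMr // lerBrDl ltW.
  rewrite /psi !smoothstep_eq1 ?subrr //; apply: (le_trans yt).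
  by rewrite ler_pM2l // lerD2l lerN2 ltW.
Qed.

Let psi_cvg c t : psi n c t @[n --> \oo] --> ((c < t)%R%:R : R).
Proof.
have [ct|tc] := ltP c t.
  apply: cvg_near_cst; near=> n; rewrite /psi smoothstep_eq1 //.
  rewrite -ler_pdivrMr ?subr_gt0 // ltW //; near: n; exact: near_infty_ltSr.
apply: cvg_near_cst; near=> n; rewrite /psi smoothstep_eq0 //.
by rewrite pmulr_rle0 ?subr_le0 // ltr0n.
Unshelve. all: by end_near. Qed.

Let gpsi_cvg x y : 0 < x -> x < y -> y < T ->
  \int[mu]_(t in `]0, T[) (g t * (psi n x t - psi n y t)) @[n --> \oo] -->
  \int[mu]_(t in `]x, y]) g t.
Proof.
move=> x0 xy yT.
have mD : measurable (`]0, T[ : set R) by exact: measurable_itv.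
have giD : mu.-integrable `]0, T[ (EFin \o g) by exact: integrableS gi.
have /integrableP[/measurable_EFinP mg _] := giD.
have mpsi n : measurable_fun `]0, T[ (fun t => psi n x t - psi n y t).
  apply: measurable_funTS; apply: measurable_funB.
    exact: continuous_measurable_fun (@psi_continuous n x).
  exact: continuous_measurable_fun (@psi_continuous n y).
have [] := @dominated_convergence _ _ _ mu _ mD
  (fun n t => (g t * (psi n x t - psi n y t))%:E)
  (fun t => (g t * ((x < t)%R%:R - (y < t)%R%:R))%:E)
  (fun t => `|g t|%:E).
- by move=> n; apply/measurable_EFinP; apply: measurable_funM; [exact: mg|exact: mpsi].
- apply/measurable_EFinP; apply: measurable_funM; first exact: mg.
  apply: measurable_funTS.
  have mind (c : R) : measurable_fun setT (fun t : R => (c < t)%R%:R : R).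
    have -> : (fun t : R => (c < t)%R%:R : R) = fun t => if c < t then 1 else 0.
      by apply/funext => t; case: ifP.
    by apply: measurable_fun_ifT => //; exact: measurable_fun_ltr.
  by apply: measurable_funB; exact: mind.
- apply: aeW => t _; apply: cvg_EFin; first exact: nearW.
  by apply: cvgMr; apply: cvgB; exact: psi_cvg.
- exact: integrable_norm giD.
- apply: aeW => t n _; rewrite /= lee_fin normrM ler_piMr //.
  have /andP[] := smoothstep_itv (n.+1%:R * (t - x)); rewrite -/(psi n x t).
  have /andP[] := smoothstep_itv (n.+1%:R * (t - y)); rewrite -/(psi n y t).
  by move=> ? ? ? ?; rewrite ler_norml; apply/andP; split; lra.
move=> fi _ gl; have := gl; rewrite -[X in _ --> X -> _]fineK; last first.
  exact: integrable_fin_num.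
move=> /fine_cvg.
suff -> : fine (\int[mu]_(t in `]0%R, T[) (g t * ((x < t)%R%:R - (y < t)%R%:R))%:E)%E
  = \int[mu]_(t in `]x, y]) g t by exact.
have -> : `]x, y]%classic = `]0, T[ `&` `]x, y] :> set R.
  apply/esym/setIidr => t /=; rewrite !in_itv /= => /andP[xt ty].
  by rewrite (lt_trans x0 xt) (le_lt_trans ty yT).
rewrite Rintegral_mkcondr; apply: eq_Rintegral => t _.
rewrite patchE mem_setE in_itv /=.
have [xt|tx] := ltP x t; have [yt|ty] := ltP y t => /=.
- by rewrite subrr mulr0.
- by rewrite subr0 mulr1.
- by move: (lt_trans xy yt); rewrite ltNge tx.
- by rewrite subrr mulr0.
Qed.

(** The difference of the smoothed steps at x and at y is a test function which
    tends boundedly to the indicator of ]x, y], while its derivative is the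
    difference of two approximate identities, at x and at y. *)
Lemma weak_derivative_increment x y : 0 < x -> x < y -> y < T ->
  u y - u x = \int[mu]_(t in `]x, y]) g t.
Proof.
move=> x0 xy yT; have xT := lt_trans xy yT; have y0 := lt_trans x0 xy.
have uu : \int[mu]_(t in `]0, T[) (u t * k n x t) -
    \int[mu]_(t in `]0, T[) (u t * k n y t) @[n --> \oo] --> u x - u y.
  by apply: cvgB; exact: mollifier_cvg.
have gg : - (\int[mu]_(t in `]0, T[) (g t * (psi n x t - psi n y t))) @[n --> \oo]
    --> - \int[mu]_(t in `]x, y]) g t.
  by apply: cvgN; exact: gpsi_cvg.
suff E : \forall n \near \oo,
    \int[mu]_(t in `]0, T[) (u t * k n x t) -
    \int[mu]_(t in `]0, T[) (u t * k n y t) =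
    - (\int[mu]_(t in `]0, T[) (g t * (psi n x t - psi n y t))).
  have : u x - u y = - (\int[mu]_(t in `]x, y]) g t).
    rewrite -(cvg_lim (@Rhausdorff R) uu); apply: cvg_lim => //.
    by apply: cvg_trans gg; apply: near_eq_cvg; apply: filterS E => n ->.
  lra.
near=> n.
have Ny : y + 2 / n.+1%:R < T.
  rewrite -ltrBrDl ltr_pdivrMr ?ltr0n // mulrC -ltr_pdivrMr ?subr_gt0 //.
  near: n; exact: near_infty_ltSr.
have tphi := bump_test x0 xy Ny.
have ukD c : mu.-integrable `]0, T[ (EFin \o (fun t => u t * k n c t)).
  by apply: integrableS (uk_integrable n c u_cont) => //; exact: subset_itv_oo_cc.
rewrite -(ug tphi) -RintegralB //; apply: eq_Rintegral => t _.
have d : is_derive t (1 : R) (fun t => psi n x t - psi n y t) (k n x t - k n y t).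
  exact: is_deriveB.
by rewrite derive1E; case: d => _ ->; rewrite mulrBr.
Unshelve. all: by end_near. Qed.

End weak_derivative_ftc.

Lemma differentiable_on_segment_continuous (R : realType) (a b : R) (u : R -> R) :
  differentiable_on_segment a b u -> {within `[a, b], continuous u}.
Proof.
move=> du; apply/subspace_continuousP => t tab.
have /cvg_ex [l ql] := du t tab.
have : (u s - u t) / (s - t) * (s - t) @[s --> within `[a, b] t^'] --> l * (t - t).
  apply: cvgM; first exact: ql.
  apply: cvgB; last exact: cvg_cst.
  apply: cvg_trans (cvg_within _) _ => /=.
  exact: nbhs_dnbhs.
rewrite subrr mulr0 => q0.
apply/cvgrPdist_le => e e0.
move/cvgr0Pnorm_le: q0 => /(_ e e0).
apply: (@filterS _ (nbhs t)) => s h sab.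
have [->|st] := eqVneq s t; first by rewrite subrr normr0 ltW.
by move: (h st sab); rewrite divfK ?subr_eq0 // distrC.
Qed.

(** On the bounded interval the constant 1 is integrable, and |g| <= 1 + g^2. *)
Lemma square_integrable_integrable (R : realType) (T : R) (g : R -> R) :
  square_integrable T g ->
  (@lebesgue_measure R).-integrable setT (EFin \o (g \_ `]0, T[)).
Proof.
move=> gL2; set D : set R := `]0, T[%classic.
have mD : measurable D by exact: measurable_itv.
have mg : measurable_fun setT (g \_ D).
  by have := sub_Lfun_mfun gL2; rewrite inE.
have sq := Lfun2_integrable_sqr gL2.
have Dlty : (@lebesgue_measure R D < +oo)%E.
  by rewrite lebesgue_measure_itv /=; case: ifP => _; rewrite ?ltry.
have c1 : (@lebesgue_measure R).-integrable D (EFin \o cst (1 : R)).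
  apply: measurable_bounded_integrable => //.
  by exists 1; split => // M M1 x _; rewrite /= normr1 ltW.
have {}c1 : (@lebesgue_measure R).-integrable setT (EFin \o (cst (1 : R) \_ D)).
  have := (@integrable_mkcond _ _ _ (@lebesgue_measure R) D (EFin \o cst (1 : R)) mD).1 c1.
  by rewrite restrict_EFin.
apply: (le_integrable _ _ _ (integrableD measurableT c1 sq)) => //.
- exact/measurable_EFinP.
- move=> x _; rewrite /= lee_fin /patch; case: ifP => _; last first.
    by rewrite normr0 normr_ge0.
  rewrite [leRHS]ger0_norm ?addr_ge0 ?sqr_ge0 //= -[_ ^+ 2]real_normK ?num_real //.
  by have := sqr_ge0 (`|g x| - 1); nra.
Qed.

(** * Pointwise and weak derivatives *)

(** At an interior point, points near t lie in [a, b], so the restricted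
    difference quotient has the same limit as the unrestricted one. *)
Lemma differentiable_on_segment_derivable (R : realType) (a b t : R) (u : R -> R) :
  differentiable_on_segment a b u -> t \in `]a, b[ -> derivable u t 1.
Proof.
move=> du tab.
have /cvg_ex [l ql] := du t (subset_itv_oo_cc tab).
apply/cvg_ex; exists l.
have qt : (u s - u t) / (s - t) @[s --> t^'] --> l.
  move=> A /ql; rewrite /dnbhs /within /= /nbhs /= => h.
  have : \forall s \near t, s \in `]a, b[ by exact: near_in_itvoo.
  move: h; apply: (@filterS2 _ (nbhs t)) => s h sab st; apply: h => //.
  exact: subset_itv_oo_cc sab.
have sh : h + t @[h --> (0 : R)^'] --> t^'.
  move=> A; rewrite /dnbhs /within /= => At.
  have c : h + t @[h --> (0 : R)] --> t.
    by rewrite -[X in _ --> X]add0r; apply: cvgD; [exact: cvg_id|exact: cvg_cst].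
  move: (c _ At) => /=; apply: (@filterS _ (nbhs (0 : R))) => h /= + h0.
  by apply; rewrite -subr_eq0 addrK.
have := cvg_comp _ _ sh qt.
apply: cvg_trans; apply: near_eq_cvg; near=> h.
by rewrite /= addrK mulrC /GRing.scale /= mulr1.
Unshelve. all: by end_near. Qed.

Section representation.
Variables (R : realType) (T : R) (u g : R -> R).
Notation mu := (@lebesgue_measure R).
Hypotheses (T0 : 0 < T) (u_cont : {within `[0, T], continuous u}).
Hypotheses (gi : mu.-integrable setT (EFin \o g)) (ug : weak_derivative T u g).

Let G (t : R) : R := \int[mu]_(s in `[0, t]) g s.

Let giS (I : interval R) : mu.-integrable [set` I] (EFin \o g).
Proof. by apply: integrableS gi => //; exact: measurable_itv. Qed.

(** [weak_derivative_increment] makes u minus the primitive of g constant on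
    ]0, T[, hence on [0, T] by continuity. *)
Lemma weak_derivative_representation t : t \in `[0, T] -> u t = u 0 + G t.
Proof.
pose h s := u s - G s.
have hc : {within `[0, T], continuous h}.
  by move=> s; apply: cvgB;
    [exact: u_cont|exact: (parameterized_integral_continuous (ltW T0) (giS `[0, T]))].
have hlt x y : 0 < x -> x < y -> y < T -> h x = h y.
  move=> x0 xy yT; have := weak_derivative_increment T0 u_cont gi ug x0 xy yT.
  rewrite -(@Rintegral_itvB _ _ (BLeft 0)) ?bnd_simp ?ltW //.
  by rewrite /h /G; lra.
have m0 : 0 < T / 2 by rewrite divr_gt0.
have mT : T / 2 < T by rewrite ltr_pdivrMr // ltr_pMr // ltr1n.
have hm x : 0 < x -> x < T -> h x = h (T / 2).
  move=> x0 xT; have [xm|mx|-> //] := ltgtP x (T / 2); first exact: hlt.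
  by apply/esym; exact: hlt.
have /(continuous_within_itvP _ T0) [_ h0 hT] := hc.
have E0 : h 0 = h (T / 2).
  apply/esym; rewrite -(cvg_lim (@Rhausdorff R) h0); apply/esym/cvg_lim => //.
  apply: cvg_near_cst; near=> s; apply: hm.
    by near: s; exact: nbhs_right_gt.
  by near: s; exact: nbhs_right_lt.
have ET : h T = h (T / 2).
  apply/esym; rewrite -(cvg_lim (@Rhausdorff R) hT); apply/esym/cvg_lim => //.
  apply: cvg_near_cst; near=> s; apply: hm.
    by near: s; exact: nbhs_left_gt.
  by near: s; exact: nbhs_left_lt.
have G0 : G 0 = 0 by rewrite /G set_itv1 Rintegral_set1.
rewrite in_itv /= => /andP[]; rewrite le_eqVlt => /predU1P[<- _|t0].
  by rewrite G0 addr0.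
rewrite le_eqVlt => /predU1P[->|tT].
  by move: ET; rewrite -E0 /h G0; lra.
by move: (hm t t0 tT); rewrite -E0 /h G0; lra.
Unshelve. all: by end_near. Qed.

Lemma weak_derivative_ae :
  {ae mu, forall t, t \in `]0, T[ -> derive1 u t = g t}.
Proof.
have lg : locally_integrable [set: R] g.
  by apply: open_integrable_locally => //; exact: openT.
have := @FTC1 _ g (BLeft 0) (fun y => giS _) lg.
apply: filterS; first exact: (ae_filter_ringOfSetsType mu).
move=> t /= + tT.
have t0 : 0 < t by move: tT; rewrite in_itv /= => /andP[].
rewrite lte_fin => /(_ t0) [dG <-].
have dG' : is_derive t (1 : R) G (derive1 G t) by apply: DeriveDef; rewrite -?derive1E.
have du : is_derive t (1 : R) (fun s => u 0 + G s) (derive1 G t).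
  by have := is_deriveD (is_derive_cst (u 0) t 1) dG'; rewrite add0r.
rewrite derive1E; apply: (@derive_val _ _ _ _ _ _ _ _).
apply: near_eq_is_derive du; near=> s.
apply/esym/weak_derivative_representation; apply: subset_itv_oo_cc.
by near: s; exact: near_in_itvoo.
Unshelve. all: by end_near. Qed.

End representation.

Section sobolev_derivative.
Variables (R : realType) (T : R) (u : R -> R).
Notation mu := (@lebesgue_measure R).
Hypotheses (T0 : 0 < T) (du : differentiable_on_segment 0 T u).

(** The derivative is a pointwise limit of difference quotients.  Borel
    measurability has to be established separately: agreeing almost everywhere
    with a Borel function does not give it, as Lebesgue measure is taken on the
    Borel sets. *)
Lemma derive1_measurable : measurable_fun `]0, T[ (derive1 u).
Proof.
have mI (I : interval R) : measurable [set` I] by exact: measurable_itv.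
have mu_ : measurable_fun setT (u \_ `[0, T]).
  have uc := differentiable_on_segment_continuous du.
  have mu0 : measurable_fun `[0, T] u.
    exact: (@subspace_continuous_measurable_fun R `[0, T]%classic u (mI _) uc).
  by apply/(measurable_restrictT _ _).1 => //; exact: mI.
pose q (n : nat) (t : R) : R :=
  n.+1%:R * ((u \_ `[0, T]) (t + n.+1%:R^-1) - (u \_ `[0, T]) t).
have mq n : measurable_fun `]0, T[ (q n).
  apply: measurable_funTS; apply: measurable_funM => //.
  apply: measurable_funB => //; apply: measurableT_comp => //.
  exact: measurable_funD.
suff cq t : `]0, T[%classic t -> q ^~ t @ \oo --> derive1 u t.
  exact: (measurable_fun_cvg mq cq).
move=> tT.
have d : h^-1 *: (u (h + t) - u t) @[h --> 0^'] --> derive1 u t.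
  have := differentiable_on_segment_derivable du tT.
  rewrite /derivable /derive1; under eq_fun do rewrite [_ *: 1]mulr1.
  exact.
have s0 : (forall n, n.+1%:R^-1 != 0 :> R) /\ n.+1%:R^-1 @[n --> \oo] --> (0 : R).
  by split; [move=> n; rewrite invr_eq0 pnatr_eq0|exact: cvg_harmonic].
move/cvgr_dnbhsP: d => /(_ _ s0); apply: cvg_trans; apply: near_eq_cvg.
move: tT; rewrite /= in_itv /= => /andP[t0 tT].
near=> n.
have n0 : 0 < n.+1%:R^-1 :> R by rewrite invr_gt0.
have nt : n.+1%:R^-1 < T - t.
  rewrite -[ltRHS]invrK ltf_pV2 ?posrE ?invr_gt0 ?subr_gt0 ?ltr0n //.
  near: n; exact: near_infty_ltSr.
rewrite /q /GRing.scale /= invrK [_ + t]addrC !patchE !mem_setE !in_itv /=.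
rewrite (ltW t0) (ltW tT) addr_ge0 ?ltW //=.
by rewrite -ltrBrDl.
Unshelve. all: by end_near. Qed.

Lemma sobolev_derivative : sobolev_H1 T u ->
  mu.-integrable `]0, T[ (EFin \o derive1 u) /\
  forall s t, 0 <= s -> s <= t -> t <= T ->
    \int[mu]_(x in `]s, t[) derive1 u x = u t - u s.
Proof.
move=> [_ [g0 gL2 ug0]].
pose g := g0 \_ `]0, T[.
have gi : mu.-integrable setT (EFin \o g) by exact: square_integrable_integrable.
have ug : weak_derivative T u g.
  move=> phi tphi; rewrite ug0 //; congr (- _); apply: eq_Rintegral => x xT.
  by rewrite /g patchE xT.
have uc := differentiable_on_segment_continuous du.
have mI (I : interval R) : measurable [set` I] by exact: measurable_itv.
have giS (I : interval R) : mu.-integrable [set` I] (EFin \o g).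
  by apply: integrableS gi.
have /integrableP[/measurable_EFinP mg glty] := giS `]0, T[.
have md := derive1_measurable.
have ae : ae_eq mu `]0, T[%classic (EFin \o derive1 u) (EFin \o g).
  have := weak_derivative_ae T0 uc gi ug.
  apply: filterS; first exact: (ae_filter_ringOfSetsType mu).
  by move=> t h tT /=; rewrite h.
have di : mu.-integrable `]0, T[ (EFin \o derive1 u).
  apply/integrableP; split; first exact/measurable_EFinP.
  rewrite (@ae_eq_integral _ _ _ mu _ (fun x => `|(EFin \o g) x|)%E) //.
  - by apply: measurableT_comp => //; exact/measurable_EFinP.
  - by apply: measurableT_comp => //; exact/measurable_EFinP.
  - case: ae => N [mN N0 sN]; exists N; split => //; apply: subset_trans sN.
    by apply: subsetC => t h tT; exact: (congr1 abse (h tT)).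
split => // s t s0 st tT.
have sub : `]s, t[%classic `<=` `]0, T[%classic.
  by move=> x; rewrite /= !in_itv /= => /andP[sx xt];
    rewrite (le_lt_trans s0 sx) (lt_le_trans xt tT).
transitivity (\int[mu]_(x in `]s, t[) g x).
  congr fine; apply: ae_eq_integral => //.
  - by apply/measurable_EFinP; apply: measurable_funS md.
  - by apply/measurable_EFinP; apply: measurable_funS mg.
  - case: ae => N [mN N0 sN]; exists N; split => //; apply: subset_trans sN.
    by apply: subsetC => x /= h xst; apply: h; exact: sub.
have rep := weak_derivative_representation T0 uc gi ug.
rewrite (rep t) ?(rep s) ?in_itv /= ?s0 ?(le_trans s0 st) ?(le_trans st tT) //.
rewrite Rintegral_itv_bndo_bndc // -(@Rintegral_itvB _ _ (BLeft 0)) ?bnd_simp //.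
ring.
Qed.

End sobolev_derivative.

(** * Integration against a monotone kernel *)

Section monotone_kernel.
Variables (R : realType) (t1 : R) (p k : R -> R) (M : R).
Notation mu := (@lebesgue_measure R).
Let D : set R := `]0, t1[%classic.
Hypothesis p_int : mu.-integrable D (EFin \o p).
Hypothesis tail : forall s, 0 <= s -> s <= t1 -> 0 <= \int[mu]_(x in `]s, t1[) p x.
Hypothesis k_ndecr : {homo k : x y / x <= y}.
Hypothesis k_itv : forall x, 0 <= k x <= M.

(** A superlevel set of a nondecreasing function in ]0, t1[ is a final segment,
    open or closed at its infimum. *)
Lemma superlevel_Rintegral_ge0 c :
  0 <= \int[mu]_(x in D) ((c <= k x)%R%:R * p x).
Proof.
pose E := D `&` [set x | c <= k x].
have -> : \int[mu]_(x in D) ((c <= k x)%R%:R * p x) = \int[mu]_(x in E) p x.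
  rewrite Rintegral_mkcondr; apply: eq_Rintegral => x _.
  rewrite patchE; have [ck|nck] := boolP (c <= k x).
    by rewrite mem_set ?mul1r.
  by rewrite memNset ?mul0r //=; exact/negP.
have [->|/set0P [y0 Ey0]] := eqVneq E set0; first by rewrite Rintegral_set0.
have lbE : lbound E 0 by move=> x [] /=; rewrite /D /= in_itv /= => /andP[/ltW].
have hlb : has_lbound E by exists 0.
have hinf : has_inf E by split; first exists y0.
pose s0 := inf E.
have s00 : 0 <= s0 by apply: lb_le_inf => //; exists y0.
have Elt y : E y -> s0 <= y /\ y < t1.
  move=> Ey; split; first exact: ge_inf.
  by case: Ey; rewrite /D /= in_itv /= => /andP[].
have s0t : s0 <= t1 by have [a b] := Elt _ Ey0; exact/ltW/(le_lt_trans a b).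
have ltE y : s0 < y -> y < t1 -> E y.
  rewrite -subr_gt0 => sy yt; have [z Ez zy] := inf_adherent sy hinf.
  move: sy; rewrite subr_gt0 => sy.
  have {}zy : z < y by move: zy; rewrite -/s0; lra.
  have Dy : D y by rewrite /D /= in_itv /= yt (le_lt_trans s00 sy).
  by case: Ez => Dz /= cz; split => //=; apply: (le_trans cz); exact/k_ndecr/ltW.
have [Es0|nEs0] := pselect (E s0).
  have EE : E = `[s0, t1[%classic.
    apply/seteqP; split => y; rewrite /= in_itv /=.
      by move/Elt => [-> ->].
    by rewrite le_eqVlt => /andP[/predU1P[<- //|]]; exact: ltE.
  have s0t0 : 0 <= \int[mu]_(x in `]s0, t1[) p x by exact: tail.
  rewrite EE -Rintegral_itv_obnd_cbnd //.
  apply: integrableS p_int; [exact: measurable_itv..|].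
  by move=> y; rewrite /D /= !in_itv /= => /andP[sy ->]; rewrite (le_lt_trans s00 sy).
have -> : E = `]s0, t1[%classic.
  apply/seteqP; split => y; rewrite /= in_itv /=; last by case/andP; exact: ltE.
  move=> Ey; have [sy ->] := Elt y Ey; rewrite andbT lt_neqAle sy andbT.
  by apply/eqP => e; apply: nEs0; rewrite e.
exact: tail.
Qed.

(** The sum counts the positive integers up to z: it is the floor of z. *)
Lemma sum_levels (z : R) (J : nat) : 0 <= z -> z <= J%:R ->
  `|z - \sum_(j < J) (j.+1%:R <= z)%R%:R| <= 1.
Proof.
move=> z0 zJ; suff /andP[] : 0 <= z - \sum_(j < J) (j.+1%:R <= z)%R%:R <= 1.
  by move=> ? ?; rewrite ger0_norm.
have {}zJ : z <= J%:R + 1 by rewrite (le_trans zJ) // lerDl.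
elim: J zJ => [|J IH] zJ; first by rewrite big_ord0 subr0 z0 -[leRHS]add0r.
rewrite big_ord_recr /=; have [Jz|zJ1] := leP J.+1%:R z.
  rewrite (eq_bigr (fun=> 1)); last first.
    by move=> i _; rewrite (le_trans _ Jz) // ler_nat ltnS ltnW.
  rewrite sumr_const card_ord natr1 subr_ge0 Jz /= lerBlDl.
  exact: zJ.
by rewrite addr0; apply: IH; rewrite natr1 ltW.
Qed.

Let mD : measurable D. Proof. exact: measurable_itv. Qed.

Let bounded_integrable (h : R -> R) (C : R) : measurable_fun setT h ->
  (forall x, `|h x| <= C) -> mu.-integrable D (EFin \o (fun x => h x * p x)).
Proof.
move=> mh hC.
have mhD : measurable_fun D h by exact: measurable_funTS.
have bh : [bounded h x | x in D].
  by exists C; split; [exact: num_real|move=> N CN x _; exact: le_trans (ltW CN)].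
have hp := @integrableMr _ _ _ mu D mD h (EFin \o p) mhD bh p_int.
by apply: eq_integrable hp => // x _; rewrite /= EFinM.
Qed.

Lemma monotone_kernel_integrable :
  mu.-integrable D (EFin \o (fun x => k x * p x)).
Proof.
apply: (@bounded_integrable k M); first exact: nondecreasing_measurable.
by move=> x; have /andP[k0 kM] := k_itv x; rewrite ger0_norm.
Qed.

(** Rounding k down to a multiple of 1 / N writes it, up to an error of 1 / N,
    as 1 / N times a sum of indicators of superlevel sets.  The integral of k p
    is thus at least - 1 / N times the integral of |p|, for every N. *)
Lemma monotone_kernel_Rintegral_ge0 : 0 <= \int[mu]_(x in D) (k x * p x).
Proof.
have mk : measurable_fun setT k by exact: nondecreasing_measurable.
have [J _ MJ] : \forall J \near \oo, M <= J%:R by exact: nbhs_infty_ger.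
have {MJ} MJ : M <= J%:R by exact: MJ J (leqnn J).
pose C := \int[mu]_(x in D) `|p x|.
suff step n : - (C / n.+1%:R) <= \int[mu]_(x in D) (k x * p x).
  have C0 : - (C / n.+1%:R) @[n --> \oo] --> (0 : R).
    rewrite -oppr0; apply: cvgN; rewrite -(mulr0 C); apply: cvgMr.
    exact: cvg_harmonic.
  by apply: (cvgr_to_le C0); near=> n; exact: step.
pose N : R := n.+1%:R; have N0 : 0 < N by rewrite ltr0n.
pose l (j : nat) (x : R) : R := (j.+1%:R / N <= k x)%R%:R.
have lE j x : l j x = (j.+1%:R <= N * k x)%R%:R by rewrite /l ler_pdivrMr // mulrC.
have ml j : measurable_fun setT (l j).
  have -> : l j = fun x => if j.+1%:R / N <= k x then 1 else 0.
    by apply/funext => x; rewrite /l; case: ifP.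
  by apply: measurable_fun_ifT => //; exact: measurable_fun_ler.
have l1 j x : `|l j x| <= 1 by rewrite /l ger0_norm // lern1; case: (_ <= _).
have li j : mu.-integrable D (EFin \o (fun x => l j x * p x)).
  exact: bounded_integrable (ml j) (l1 j).
(* N k takes its values in [0, N M], so K = N J levels suffice. *)
pose K := (n.+1 * J)%N.
have Kk x : `|N * k x - \sum_(j < K) l j x| <= 1.
  under eq_bigr do rewrite lE.
  have /andP[k0 kM] := k_itv x.
  apply: sum_levels; first by rewrite mulr_ge0 // ltW.
  by rewrite natrM ler_wpM2l // (le_trans kM).
have [si s0] : mu.-integrable D (EFin \o (fun x => \sum_(j < K) l j x * p x)) /\
    0 <= \int[mu]_(x in D) (\sum_(j < K) l j x * p x).
  elim: K {Kk} => [|m [IHi IH]].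
    split; last by apply: Rintegral_ge0 => x _; rewrite big_ord0.
    apply: eq_integrable (integrable0 _ _) => // x _ /=.
    by rewrite big_ord0.
  have E : (fun x => \sum_(j < m.+1) l j x * p x) =
      fun x => \sum_(j < m) l j x * p x + l m x * p x.
    by apply/funext => x; rewrite big_ord_recr.
  rewrite E; split; first by apply: eq_integrable (integrableD _ IHi (li m)).
  by rewrite RintegralD // addr_ge0 // superlevel_Rintegral_ge0.
have ki := monotone_kernel_integrable.
have ni : mu.-integrable D (EFin \o (fun x => `|p x|)) by exact: integrable_norm p_int.
have : \int[mu]_(x in D) (\sum_(j < K) l j x * p x - `|p x|) <=
       \int[mu]_(x in D) (N * (k x * p x)).
  apply: le_Rintegral => //.
  - by apply: eq_integrable (integrableB _ si ni).
  - have nki := integrableZl _ N ki.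
    by apply: eq_integrable (nki mD) => // x _; rewrite /= EFinM.
  - move=> x _; rewrite -mulr_suml mulrA lerBlDr -lerBlDl -mulrBl.
    apply: (le_trans (ler_norm _)); rewrite normrM -[leRHS]mul1r.
    by rewrite ler_wpM2r // distrC.
rewrite RintegralB // RintegralZl // -/C => h.
rewrite lerNl ler_pdivlMr // mulNr lerNl mulrC; apply: le_trans h.
by rewrite lerDr.
Unshelve. all: by end_near. Qed.

End monotone_kernel.

(** * The comparison principle *)

(** The zero is the infimum of the points of [0, T] where m is nonnegative. *)
Lemma first_zero (R : realType) (T t : R) (m : R -> R) :
  {within `[0, T], continuous m} -> m 0 < 0 -> t \in `[0, T] -> 0 <= m t ->
  exists t1 : R, [/\ 0 < t1, t1 <= T, m t1 = 0 &
    forall s, 0 <= s -> s < t1 -> m s < 0].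
Proof.
move=> /subspace_continuousP mc m0 tT mt.
pose A := [set s | s \in `[0, T] /\ 0 <= m s].
have At : A t by [].
have hl : has_lbound A by exists 0 => s [+ _]; rewrite in_itv /= => /andP[].
pose t1 := inf A.
have t10 : 0 <= t1.
  by apply: lb_le_inf; [exists t|move=> s [+ _]; rewrite in_itv /= => /andP[]].
have t1T : t1 <= T.
  by apply: (le_trans (ge_inf hl At)); move: tT; rewrite in_itv /= => /andP[].
have neg s : 0 <= s -> s < t1 -> m s < 0.
  move=> s0 st; rewrite ltNge; apply/negP => ms.
  have /(ge_inf hl) : A s by split => //; rewrite in_itv /= s0 (le_trans (ltW st)).
  by rewrite leNgt st.
have t1J : `[0, T]%classic t1 by rewrite /= in_itv /= t10.
have cm := mc _ t1J.
have ge0 : 0 <= m t1.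
  rewrite leNgt; apply/negP => m1.
  have : \forall s \near t1, `[0, T]%classic s -> m s < 0 by exact: (cvgr_lt _ cm).
  move=> /nbhs_ballP [d /= d0 dP].
  have [s As sd] := inf_adherent d0 (conj (ex_intro _ t At) hl).
  have ts : t1 <= s by exact: ge_inf.
  have : m s < 0.
    apply: dP; last by case: As.
    by rewrite /ball /= distrC ger0_norm ?subr_ge0 // ltrBlDl.
  by case: As => _; rewrite leNgt => /negP.
have t1_gt0 : 0 < t1.
  rewrite lt_neqAle t10 andbT; apply/eqP => e.
  by move: ge0; rewrite -e leNgt m0.
exists t1; split => //; apply/eqP; rewrite eq_le ge0 andbT leNgt.
apply/negP => m1.
have : \forall s \near t1, `[0, T]%classic s -> 0 < m s by exact: (cvgr_gt _ cm).
move=> /nbhs_ballP [d /= d0 dP].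
pose s := Num.max 0 (t1 - d / 2).
have s0 : 0 <= s by rewrite le_max lexx.
have st : s < t1 by rewrite gt_max t1_gt0 /= ltrBlDr ltrDl divr_gt0.
have sd : t1 - d / 2 <= s by rewrite le_max lexx orbT.
have := neg s s0 st; rewrite ltNge => /negP; apply; apply/ltW/dP.
  rewrite /ball /= ger0_norm ?subr_ge0 ?(ltW st) //.
  by lra.
by rewrite /= in_itv /= s0 (le_trans (ltW st)).
Qed.

(** The maximum principle: the hypothesis says that v - w attains its maximum
    over [0, t1] at t1, so that v' - w' has nonnegative integrals over all
    the intervals ]s, t1[. *)
Lemma ABC_le_of_max_at_end (R : realType) (a T t1 : R) (B : R -> R) (v w : R -> R) :
  0 < a -> a < 1 -> 0 < B a -> 0 < t1 -> t1 <= T ->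
  differentiable_on_segment 0 T v -> differentiable_on_segment 0 T w ->
  sobolev_H1 T v -> sobolev_H1 T w ->
  (forall s, 0 <= s -> s <= t1 -> v s - w s <= v t1 - w t1) ->
  ABC B a w t1 <= ABC B a v t1.
Proof.
move=> a0 a1 Ba t10 t1T dv dw sv sw vw.
have T0 := lt_le_trans t10 t1T.
have [vi vI] := sobolev_derivative T0 dv sv.
have [wi wI] := sobolev_derivative T0 dw sw.
have lam0 : 0 <= a / (1 - a) by rewrite divr_ge0 ?subr_ge0 ?ltW.
pose E (z : R) := mittag_leffler a (- (a / (1 - a) * z `^ a)).
(* Truncating t1 - s at 0 leaves k unchanged on [0, t1] and makes it
   nondecreasing and bounded on the whole line. *)
pose k s := E (Num.max (t1 - s) 0).
have kM x : 0 <= k x <= mittag_leffler a (- 0).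
  have z0 : 0 <= a / (1 - a) * (Num.max (t1 - x) 0) `^ a.
    by rewrite mulr_ge0 ?powR_ge0.
  rewrite /k /E; apply/andP; split; first exact: mittag_leffler_ge0 (ltW a1) _ z0.
  exact: mittag_leffler_nonincreasing (ltW a1) _ _ _ z0.
have kn : {homo k : x y / x <= y}.
  move=> x y xy; rewrite /k /E; apply: mittag_leffler_nonincreasing; rewrite ?(ltW a1) //.
    by rewrite mulr_ge0 ?powR_ge0.
  apply: ler_wpM2l => //; apply: ge0_ler_powR; first exact: ltW.
  - by rewrite nnegrE le_max lexx orbT.
  - by rewrite nnegrE le_max lexx orbT.
  - by rewrite ge_max !le_max lexx orbT andbT lerD2l lerN2 xy.
pose D : set R := `]0, t1[%classic.
have sub : D `<=` `]0, T[%classic.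
  by move=> x; rewrite /D /= !in_itv /= => /andP[-> /lt_le_trans]; exact.
have mI (I : interval R) : measurable [set` I] by exact: measurable_itv.
have viD : (@lebesgue_measure R).-integrable D (EFin \o derive1 v).
  by apply: integrableS vi => //; exact: mI.
have wiD : (@lebesgue_measure R).-integrable D (EFin \o derive1 w).
  by apply: integrableS wi => //; exact: mI.
have kvi := monotone_kernel_integrable viD kn kM.
have kwi := monotone_kernel_integrable wiD kn kM.
have ABCE u : (@lebesgue_measure R).-integrable D (EFin \o (fun x => k x * derive1 u x)) ->
    ABC B a u t1 = B a / (1 - a) * \int[@lebesgue_measure R]_(x in D) (k x * derive1 u x).
  move=> /integrableP[/measurable_EFinP mk _].
  rewrite /ABC (Rintegral_itv_oo_cc mk); congr (_ * _).
  apply: eq_Rintegral => s.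
  rewrite inE /= in_itv /= => /andP[s0 st].
  by rewrite /k /E max_l ?subr_ge0 // mulNr.
rewrite (ABCE v kvi) (ABCE w kwi); apply: ler_wpM2l; first by rewrite divr_ge0 ?subr_ge0 ?ltW.
rewrite -subr_ge0 -RintegralB //; last exact: mI.
under eq_Rintegral do rewrite -mulrBr.
apply: (monotone_kernel_Rintegral_ge0 (M := mittag_leffler a (- 0))) => //.
  by apply: eq_integrable (integrableB _ viD wiD) => //; exact: mI.
move=> s s0 st.
have sub' : `]s, t1[%classic `<=` `]0, T[%classic.
  by move=> x; rewrite /= !in_itv /= => /andP[sx xt];
    rewrite (le_lt_trans s0 sx) (lt_le_trans xt t1T).
rewrite RintegralB //; last 2 first.
- exact: integrableS vi.
- exact: integrableS wi.
by rewrite vI // wI //; have := vw s s0 st; lra.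
Qed.

Theorem theorem4p1 (R : realType) (B : R -> R) (a T : R)
    (f : R * R -> R) (v w : R -> R)
    (a_gt0 : 0 < a) (a_lt1 : a < 1) (T_gt0 : 0 < T)
    (Ba_gt0 : 0 < B a) (B0 : B 0 = 1) (B1 : B 1 = 1)
    (f_cont : {within `[0, T] `*` [set: R], continuous f})
    (v_diff : differentiable_on_segment 0 T v)
    (w_diff : differentiable_on_segment 0 T w)
    (v_dom : sobolev_H1 T v) (w_dom : sobolev_H1 T w)
    (Dv_cont : {within `[0, T], continuous (ABC B a v)})
    (Dw_cont : {within `[0, T], continuous (ABC B a w)})
    (v_le : forall t : R, t \in `[0, T] -> ABC B a v t <= f (t, v t))
    (w_ge : forall t : R, t \in `[0, T] -> f (t, w t) <= ABC B a w t)
    (strict : (forall t : R, t \in `[0, T] -> ABC B a v t < f (t, v t)) \/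
              (forall t : R, t \in `[0, T] -> f (t, w t) < ABC B a w t))
    (vw0 : v 0 < w 0) :
  forall t : R, t \in `[0, T] -> v t < w t.
Proof.
move=> t tT; rewrite ltNge; apply/negP => wv.
have m_cont : {within `[0, T], continuous (fun s => v s - w s)}.
  by move=> s; apply: cvgB; exact: differentiable_on_segment_continuous.
have [| |t1 [t10 t1T m1 mneg]] := first_zero m_cont _ tT.
- by rewrite subr_lt0.
- by rewrite subr_ge0.
have le_ABC : ABC B a w t1 <= ABC B a v t1.
  apply: (@ABC_le_of_max_at_end _ a T) => // s s0; rewrite le_eqVlt m1.
  by move=> /predU1P[->|st]; [rewrite m1|exact/ltW/mneg].
have t1J : t1 \in `[0, T] by rewrite in_itv /= (ltW t10).
have vw1 : v t1 = w t1 by apply/eqP; rewrite -subr_eq0 m1.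
have := v_le t1 t1J; have := w_ge t1 t1J; rewrite vw1 => w_ge1 v_le1.
case: strict => /(_ t1 t1J) h; rewrite ?vw1 in h.
  by have := le_lt_trans (le_trans w_ge1 le_ABC) h; rewrite ltxx.
by have := lt_le_trans h (le_trans le_ABC v_le1); rewrite ltxx.
Qed.
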